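(* Let $K$ be a field with a positive definite involution, let $\overline{n}=(n_i)_{i\in\mathbb{N}}$ be a sequence of integers $n_i\ge 2$ with associated supernatural number $n=\prod_{i}n_i$, and let $\mathcal{O}(\overline{n})$ be the generalized odometer algebra over $K$, with $*$-regular closure $\mathcal{R}_{\mathcal{O}(\overline{n})}$. Then $$\mathcal{C}'(\mathcal{O}(\overline{n}))=\mathcal{C}(\mathcal{O}(\overline{n}))=\mathcal{C}'(\mathcal{R}_{\mathcal{O}(\overline{n})})=\mathbb{Z}(n)^+.$$ In particular, $\mathcal{G}(\mathcal{O}(\overline{n}))=\mathbb{Z}(n)$.
   Context: A positive definite involution on a field $K$ is an involution $a\mapsto\overline{a}$ such that for all $r\ge 1$, $\sum_{i=1}^r\overline{a_i}a_i=0$ implies all $a_i=0$. Here $\mathbb{N}=\{1,2,\dots\}$. Odometer algebra. $X=\prod_{i\in\mathbb{N}}\{0,1,\dots,n_i-1\}$ with the product topology; $T:X\to X$ is the odometer, i.e. addition of $(1,0,0,\dots)$ with carry-over: $T(x)=(x_1+1,x_2,\dots)$ if $x_1\ne n_1-1$; $T(x)=(0,\dots,0,x_{m+1}+1,x_{m+2},\dots)$ if $x_j=n_j-1$ for $1\le j\le m$ and $x_{m+1}\ne n_{m+1}-1$; $T(x)=(0,0,\dots)$ if $x_i=n_i-1$ for all $i$. $C_K(X)$ is the algebra of locally constant functions $X\to K$, and $\mathcal{O}(\overline{n})=C_K(X)\rtimes_T\mathbb{Z}$ is the crossed product $*$-algebra, with $t$ the unitary implementing the action: $t\chi_Ut^{-1}=\chi_{T(U)}$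 for $U$ clopen, where $\chi_U$ is the characteristic function of $U$. Let $\mu$ be the product on $X$ of the uniform probability measures on the factors. Rank function and $*$-regular closure. A Sylvester matrix rank function on a unital ring $R$ is a map $\mathrm{rk}$ from finite matrices over $R$ to $\mathbb{R}_{\ge0}$ with $\mathrm{rk}(0)=0$, $\mathrm{rk}(1)=1$; $\mathrm{rk}(M_1M_2)\le\min\{\mathrm{rk}(M_1),\mathrm{rk}(M_2)\}$; $\mathrm{rk}\begin{pmatrix}M_1&0\\0&M_2\end{pmatrix}=\mathrm{rk}(M_1)+\mathrm{rk}(M_2)$; $\mathrm{rk}\begin{pmatrix}M_1&M_3\\0&M_2\end{pmatrix}\ge\mathrm{rk}(M_1)+\mathrm{rk}(M_2)$. It is a known fact (taken as given) that there is a unique Sylvester matrix rank function $\mathrm{rk}_{\mathcal{O}(\overline{n})}$ on $\mathcal{O}(\overline{n})$ with $\mathrm{rk}_{\mathcal{O}(\overline{n})}(\chi_U)=\mu(U)$ for every clopen $U\subseteq X$, that it is faithful, that the completion $\mathfrak{R}_{\mathrm{rk}}$ of $\mathcal{O}(\overline{n})$ with respect to the metric $d(x,y)=\mathrm{rk}_{\mathcal{O}(\overline{n})}(x-y)$ is a $*$-regular ring (a von Neumann regular ring with an involution such that $x^*x=0$ implies $x=0$), and that the rank function extends uniquely (by continuity) to a Sylvester matrix rank function on $\mathfrak{R}_{\mathrm{rk}}$. $\mathcal{R}_{\mathcal{O}(\overline{n})}$ denotes the $*$-regular closure of $\mathcal{O}(\overline{n})$ in $\mathfrak{R}_{\mathrm{rk}}$,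 i.e. the smallest unital $*$-regular subring of $\mathfrak{R}_{\mathrm{rk}}$ containing $\mathcal{O}(\overline{n})$, and $\mathrm{rk}_{\mathcal{R}_{\mathcal{O}(\overline{n})}}$ is the restriction to it of the extended rank function. Sets of values. $\mathcal{C}'(\mathcal{O}(\overline{n}))=\{\mathrm{rk}_{\mathcal{O}(\overline{n})}(A)\mid A\in M_k(\mathcal{O}(\overline{n})),\,k\ge1\}$; $\mathcal{C}(\mathcal{O}(\overline{n}))=\{k-\mathrm{rk}_{\mathcal{O}(\overline{n})}(A)\mid A\in M_k(\mathcal{O}(\overline{n})),\,k\ge1\}$ (the set of $\mathcal{O}(\overline{n})$-Betti numbers); $\mathcal{C}'(\mathcal{R}_{\mathcal{O}(\overline{n})})=\{\mathrm{rk}_{\mathcal{R}_{\mathcal{O}(\overline{n})}}(A)\mid A\in M_k(\mathcal{R}_{\mathcal{O}(\overline{n})}),\,k\ge1\}$; $\mathcal{G}(\mathcal{O}(\overline{n}))$ is the subgroup of $(\mathbb{R},+)$ generated by $\mathcal{C}(\mathcal{O}(\overline{n}))$. $\mathbb{Z}(n)$ is the additive subgroup of $\mathbb{Q}$ consisting of all fractions $\frac{a}{n_1\cdots n_r}$ with $a\in\mathbb{Z}$, $r\ge1$ (it depends only on the supernatural number $n=\prod_q q^{\varepsilon_q(n)}$, with $\varepsilon_q(n)=\sum_i\varepsilon_q(n_i)\in\{0,1,2,\dots\}\cup\{\infty\}$ for $q$ prime, where $\varepsilon_q(n_i)$ is the exponent of $q$ in $n_i$). $\mathbb{Z}(n)^+$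 is the set of non-negative elements of $\mathbb{Z}(n)$. *)

(* Defs.v *)
From HB Require Import structures.
From mathcomp Require Import all_boot all_order all_algebra.
From mathcomp Require Import finmap.
From mathcomp Require Import all_classical all_reals all_analysis.

Set Implicit Arguments.
Unset Strict Implicit.
Unset Printing Implicit Defensive.

Import Order.TTheory GRing.Theory Num.Theory.
Local Open Scope classical_set_scope.
Local Open Scope ring_scope.

HB.mixin Record isStarRing A of GRing.PzRing A := {
  star : A -> A;
  starK : involutive star;
  starD : {morph star : x y / x + y};
  starM : forall x y, star (x * y) = star y * star x
}.

#[short(type="starRingType")]
HB.structure Definition StarRing := {A of GRing.PzRing A & isStarRing A}.

#[short(type="starFieldType")]
HB.structure Definition StarField := {K of GRing.Field K & isStarRing K}.

Lemma star0 (A : starRingType) : star 0 = 0 :> A.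
Proof. by apply: (addIr (star 0)); rewrite -starD !add0r. Qed.

Lemma star1 (A : starRingType) : star 1 = 1 :> A.
Proof. by have := @starM A 1 (star 1); rewrite mul1r starK mul1r. Qed.

Lemma star_sum (A : starRingType) I (r : seq I) (F : I -> A) :
  star (\sum_(i <- r) F i) = \sum_(i <- r) star (F i).
Proof. exact: (big_morph _ (@starD A) (star0 A)). Qed.

Definition positive_definite (K : starFieldType) : Prop :=
  forall (r : nat) (a : 'I_r.+1 -> K),
    \sum_i star (a i) * a i = 0 -> forall i, a i = 0.

Record star_aut (A : starRingType) := StarAut {
  aut_fun :> A -> A;
  aut_inv : A -> A;
  aut_funK : cancel aut_fun aut_inv;
  aut_invK : cancel aut_inv aut_fun;
  autD : {morph aut_fun : x y / x + y};
  autM : {morph aut_fun : x y / x * y};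
  aut1 : aut_fun 1 = 1;
  aut_star : {morph aut_fun : x / star x}
}.

Section AutPow.
Variables (A : starRingType) (s : star_aut A).

Definition aut_pow (k : int) : A -> A :=
  match k with
  | Posz m => iter m s
  | Negz m => iter m.+1 (aut_inv s)
  end.

Lemma aut_pow0 x : aut_pow 0 x = x. Proof. by []. Qed.

Lemma aut_powS k x : aut_pow (k + 1) x = s (aut_pow k x).
Proof.
case: k => m; first by rewrite -PoszD addn1.
rewrite {1}NegzE -addn1 PoszD opprD addrNK.
by case: m => [|m]; rewrite ?oppr0 -?NegzE /= aut_invK.
Qed.

Lemma aut_powP k x : aut_pow (k - 1) x = aut_inv s (aut_pow k x).
Proof. by rewrite -{2}(subrK 1 k) aut_powS aut_funK. Qed.

Lemma aut_powD k l x : aut_pow (k + l) x = aut_pow k (aut_pow l x).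
Proof.
elim/int_ind: k => [|m IH|m IH]; first by rewrite add0r.
- by rewrite -addn1 PoszD addrAC !aut_powS IH.
- by rewrite -addn1 PoszD opprD addrAC !aut_powP IH.
Qed.

Let pow_ind (P : (A -> A) -> Prop) :
  P id -> (forall f, P f -> P (s \o f)) -> (forall f, P f -> P (aut_inv s \o f))
  -> forall k, P (aut_pow k).
Proof.
move=> P0 PS PV [m|m]; rewrite /aut_pow.
  by elim: m => [|m IH] //=; exact: PS IH.
by elim: m => [|m IH]; [exact: PV P0 | exact: PV IH].
Qed.

Lemma aut_pow_add k : {morph aut_pow k : x y / x + y}.
Proof.
move: k; apply: (@pow_ind (fun f => {morph f : x y / x + y})) =>
  [//|f fD x y|f fD x y] /=; rewrite fD; first exact: autD.
by apply: (can_inj (aut_funK s)); rewrite autD !aut_invK.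
Qed.

Lemma aut_pow_mul k : {morph aut_pow k : x y / x * y}.
Proof.
move: k; apply: (@pow_ind (fun f => {morph f : x y / x * y})) =>
  [//|f fD x y|f fD x y] /=; rewrite fD; first exact: autM.
by apply: (can_inj (aut_funK s)); rewrite autM !aut_invK.
Qed.

Lemma aut_pow1 k : aut_pow k 1 = 1.
Proof.
move: k; apply: (@pow_ind (fun f => f 1 = 1)) => [//|f f1|f f1] /=; rewrite f1; first exact: aut1.
by rewrite -[in LHS](aut1 s) aut_funK.
Qed.

Lemma aut_pow_star k : {morph aut_pow k : x / star x}.
Proof.
move: k; apply: (@pow_ind (fun f => {morph f : x / star x})) =>
  [//|f fD x|f fD x] /=; rewrite fD; first exact: aut_star.
by apply: (can_inj (aut_funK s)); rewrite aut_star !aut_invK.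
Qed.

Lemma aut_pow_zero k : aut_pow k 0 = 0.
Proof. by apply: (addIr (aut_pow k 0)); rewrite -aut_pow_add !add0r. Qed.

Lemma aut_pow_sum k I (r : seq I) (F : I -> A) :
  aut_pow k (\sum_(i <- r) F i) = \sum_(i <- r) aut_pow k (F i).
Proof. exact: (big_morph _ (@aut_pow_add k) (aut_pow_zero k)). Qed.

End AutPow.

(* [a : crossed s] stands for the finite sum \sum_k (a k) t^k, where the
   unitary t satisfies t x t^-1 = s x for x : A. *)
Definition crossed (A : starRingType) (s : star_aut A) : Type :=
  {fsfun int -> A with 0}.

Section Crossed.
Local Open Scope fset_scope.
Local Open Scope ring_scope.
Variables (A : starRingType) (s : star_aut A).
Notation C := (crossed s).
Notation sg := (aut_pow s).
Implicit Types a b c : C.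

Definition coef (a : C) (k : int) : A := (a : {fsfun int -> A with 0}) k.
Definition csupp (a : C) : {fset int} := finsupp (a : {fsfun int -> A with 0}).

HB.instance Definition _ := Choice.on (crossed s).

Definition mkcrossed (S : {fset int}) (f : int -> A) : C :=
  [fsfun k in S => f k].

Lemma crossedP a b : coef a =1 coef b -> a = b.
Proof. by move=> e; apply/fsfunP. Qed.

Lemma coef_out a k : k \notin csupp a -> coef a k = 0.
Proof. by move=> h; rewrite /coef fsfun_dflt. Qed.

Lemma mkcrossedE S f k : (k \notin S -> f k = 0) -> coef (mkcrossed S f) k = f k.
Proof.
rewrite /coef /mkcrossed fsfunE; case: ifP => // /negbT h H; exact/esym/H.
Qed.

Definition czero : C := mkcrossed fset0 (fun=> 0).
Definition cadd a b : C :=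
  mkcrossed (csupp a `|` csupp b) (fun k => coef a k + coef b k).
Definition copp a : C := mkcrossed (csupp a) (fun k => - coef a k).

Lemma coef0 k : coef czero k = 0. Proof. by rewrite mkcrossedE. Qed.
Lemma coefD a b k : coef (cadd a b) k = coef a k + coef b k.
Proof.
by rewrite mkcrossedE // in_fsetU negb_or => /andP[/coef_out-> /coef_out->];
  rewrite addr0.
Qed.
Lemma coefN a k : coef (copp a) k = - coef a k.
Proof. by rewrite mkcrossedE // => /coef_out->; rewrite oppr0. Qed.

Let caddA : associative cadd.
Proof. by move=> a b c; apply: crossedP => k; rewrite !coefD addrA. Qed.
Let caddC : commutative cadd.
Proof. by move=> a b; apply: crossedP => k; rewrite !coefD addrC. Qed.
Let cadd0 : left_id czero cadd.
Proof. by move=> a; apply: crossedP => k; rewrite coefD coef0 add0r. Qed.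
Let caddN : left_inverse czero copp cadd.
Proof. by move=> a; apply: crossedP => k; rewrite coefD coefN coef0 addNr. Qed.

HB.instance Definition _ := GRing.isZmodule.Build C caddA caddC cadd0 caddN.

(* [crossed_const x] is x t^0. *)
Definition crossed_const (x : A) : C :=
  mkcrossed [fset 0] (fun k => if k == 0 then x else 0).

(* [crossed_gen] is the unitary t. *)
Definition crossed_gen : C :=
  mkcrossed [fset 1] (fun k => if k == 1 then 1 else 0).

(* (x t^i) (y t^j) = x s^i(y) t^(i+j) *)
Definition cmul a b : C :=
  mkcrossed [fset i + j | i in csupp a, j in csupp b]
    (fun k => \sum_(i <- csupp a) coef a i * sg i (coef b (k - i))).

(* (x t^i)^* = t^-i x^* = s^-i(x^* ) t^-i *)
Definition cstar a : C :=
  mkcrossed [fset - i | i in csupp a] (fun k => sg k (star (coef a (- k)))).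

Lemma coef_const x k : coef (crossed_const x) k = if k == 0 then x else 0.
Proof. by rewrite mkcrossedE // inE => /negPf->. Qed.

Lemma coef_gen k : coef crossed_gen k = if k == 1 then 1 else 0.
Proof. by rewrite mkcrossedE // inE => /negPf->. Qed.

Lemma coefM a b k :
  coef (cmul a b) k = \sum_(i <- csupp a) coef a i * sg i (coef b (k - i)).
Proof.
rewrite mkcrossedE // => kS; rewrite big_seq big1 // => i ia.
rewrite (@coef_out b) ?aut_pow_zero ?mulr0 //.
apply: contra kS => jb; apply/imfset2P; exists i => //=; exists (k - i) => //=.
by rewrite addrC subrK.
Qed.

Lemma coefMw (S : {fset int}) a b k : csupp a `<=` S ->
  coef (cmul a b) k = \sum_(i <- S) coef a i * sg i (coef b (k - i)).
Proof.
move=> aS; rewrite coefM; apply: big_fset_incl => // i _ /coef_out->.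
by rewrite mul0r.
Qed.

Lemma coef_star a k : coef (cstar a) k = sg k (star (coef a (- k))).
Proof.
rewrite mkcrossedE // => kS; rewrite coef_out ?star0 ?aut_pow_zero //.
by apply: contra kS => h; apply/imfsetP; exists (- k); rewrite ?opprK.
Qed.

Let shift_sum (S U : {fset int}) (i : int) (F : int -> A) :
  (forall j, j \in U -> i + j \in S) ->
  (forall j, j \notin U -> F (i + j) = 0) ->
  \sum_(j <- S) F j = \sum_(j <- U) F (i + j).
Proof.
move=> US F0.
rewrite -(@big_imfset _ _ _ _ _ imfset_key (fun j => i + j) (mem U) F) /=;
  last by move=> x y _ _ /addrI.
apply/esym/big_fset_incl.
  by apply/fsubsetP => j /imfsetP[l /= lU ->]; exact: US.
move=> j _ jU; rewrite -(subrKC i j); apply: F0; apply: contra jU => h.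
by apply/imfsetP; exists (j - i) => //=; rewrite subrKC.
Qed.

Let cmulA : associative cmul.
Proof.
move=> a b c; apply: crossedP => k; apply/esym.
pose S := [fset i + j | i in csupp a, j in csupp b] `|` csupp (cmul a b).
rewrite (@coefMw S) ?fsubsetUr // coefM.
under eq_bigr do rewrite coefM mulr_suml.
rewrite exchange_big /= big_seq [RHS]big_seq; apply: eq_bigr => i ia.
rewrite coefM aut_pow_sum mulr_sumr (@shift_sum S (csupp b) i).
- apply: eq_bigr => j _; rewrite addrAC subrr add0r aut_powD aut_pow_mul mulrA.
  by rewrite opprD addrA.
- by move=> j jb; rewrite in_fsetU in_imfset2.
- by move=> j jb; rewrite addrAC subrr add0r (coef_out jb) aut_pow_zero mulr0 mul0r.
Qed.

Let cone := crossed_const 1.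

Lemma coef_constM x a k : coef (cmul (crossed_const x) a) k = x * coef a k.
Proof.
rewrite (@coefMw (0 |` csupp (crossed_const x))) ?fsubsetUr //.
rewrite (big_fsetD1 0) ?fset1U1 //= coef_const eqxx subr0 big_seq big1 ?addr0 //.
by move=> i; rewrite !inE => /andP[/negPf i0 _]; rewrite coef_const i0 mul0r.
Qed.

Lemma coef_genM a k : coef (cmul crossed_gen a) k = s (coef a (k - 1)).
Proof.
rewrite (@coefMw (1 |` csupp crossed_gen)) ?fsubsetUr //.
rewrite (big_fsetD1 1) ?fset1U1 //= coef_gen eqxx mul1r big_seq big1 ?addr0 //.
by move=> i; rewrite !inE => /andP[/negPf i0 _]; rewrite coef_gen i0 mul0r.
Qed.

Let cmul1l : left_id cone cmul.
Proof. by move=> a; apply: crossedP => k; rewrite coef_constM mul1r. Qed.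

Let cmul1r : right_id cone cmul.
Proof.
move=> a; apply: crossedP => k.
rewrite (@coefMw (k |` csupp a)) ?fsubsetUr //.
rewrite (big_fsetD1 k) ?fset1U1 //= coef_const subrr eqxx aut_pow1 mulr1.
rewrite big_seq big1 ?addr0 // => i; rewrite !inE eq_sym -subr_eq0.
by move=> /andP[/negPf i0 _]; rewrite coef_const i0 aut_pow_zero mulr0.
Qed.

Let cmulDl : left_distributive cmul cadd.
Proof.
move=> a b c; apply: crossedP => k.
pose S := csupp (cadd a b) `|` (csupp a `|` csupp b).
have aS : csupp a `<=` S by rewrite /S fsetUCA fsubsetUl.
have bS : csupp b `<=` S by rewrite /S fsetUA fsubsetUr.
rewrite coefD (coefMw _ _ (fsubsetUl _ _ : csupp (cadd a b) `<=` S)).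
rewrite (coefMw _ _ aS) (coefMw _ _ bS) -big_split.
by apply: eq_bigr => i _; rewrite coefD mulrDl.
Qed.

Let cmulDr : right_distributive cmul cadd.
Proof.
move=> a b c; apply: crossedP => k; rewrite coefD !coefM -big_split.
by apply: eq_bigr => i _; rewrite coefD aut_pow_add mulrDr.
Qed.

HB.instance Definition _ :=
  GRing.Zmodule_isPzRing.Build C cmulA cmul1l cmul1r cmulDl cmulDr.

Let cstarK : involutive cstar.
Proof.
move=> a; apply: crossedP => k; rewrite !coef_star opprK.
by rewrite -aut_pow_star -aut_powD subrr starK.
Qed.

Let cstarD : {morph cstar : a b / a + b}.
Proof.
move=> a b; apply: crossedP => k.
by rewrite coefD !coef_star coefD starD aut_pow_add.
Qed.

Let cstarM (a b : C) : cstar (a * b) = cstar b * cstar a.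
Proof.
apply: crossedP => k.
rewrite coef_star coefM star_sum aut_pow_sum.
have -> : coef (cstar b * cstar a) k =
    \sum_(j <- csupp (cstar b) `|` [fset k + i | i in csupp a])
      coef (cstar b) j * sg j (coef (cstar a) (k - j)).
  by rewrite -(@coefMw _ (cstar b)) ?fsubsetUl.
have ki i : k - (k + i) = - i by rewrite opprD addrA subrr add0r.
rewrite [RHS](@shift_sum _ (csupp a) k).
- apply: eq_bigr => i _; rewrite !coef_star ki opprK starM aut_pow_mul opprD.
  by rewrite -aut_pow_star -!aut_powD addrK.
- by move=> i ia; rewrite in_fsetU in_imfset // orbT.
move=> i ia; rewrite !coef_star ki opprK.
by rewrite (coef_out ia) star0 !aut_pow_zero mulr0.
Qed.

HB.instance Definition _ := isStarRing.Build C cstarK cstarD cstarM.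

Lemma crossed_genE x :
  crossed_gen * crossed_const x = crossed_const (s x) * crossed_gen.
Proof.
apply: crossedP => k; rewrite coef_genM coef_constM coef_const coef_gen subr_eq0.
by case: eqP => _; rewrite ?mulr1 // mulr0; exact: (aut_pow_zero s 1).
Qed.

Lemma crossed_gen_unitary :
  crossed_gen * star crossed_gen = 1 /\ star crossed_gen * crossed_gen = 1.
Proof.
have star_gen k : coef (star crossed_gen) k = if k == -1 then 1 else 0.
  rewrite coef_star coef_gen eqr_oppLR.
  by case: eqP => _; rewrite ?star1 ?aut_pow1 // star0 aut_pow_zero.
have e : crossed_gen * star crossed_gen = 1.
  apply: crossedP => k; rewrite coef_genM star_gen coef_const subr_eq addNr.
  by case: eqP => _; [exact: aut1 | exact: (aut_pow_zero s 1)].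
split=> //; apply: crossedP => k.
rewrite (@coefMw (-1 |` csupp (star crossed_gen))) ?fsubsetUr //.
rewrite (big_fsetD1 (-1)) ?fset1U1 //= star_gen eqxx mul1r big_seq big1 ?addr0.
  rewrite coef_gen coef_const opprK -[k + 1 == 1]subr_eq0 addrK.
  by case: eqP => _;
    [exact: (aut_pow1 s (-1)) | exact: (aut_pow_zero s (-1))].
by move=> i; rewrite !inE => /andP[/negPf i0 _]; rewrite star_gen i0 mul0r.
Qed.

End Crossed.

Definition locally_constant (X : topologicalType) (K : Type) (f : X -> K) :=
  forall x, \forall y \near x, f y = f x.

Section LocallyConstant.
Variables (X : topologicalType) (K : starFieldType).

Definition locally_constant_pred : pred (X -> K) :=
  fun f => `[< locally_constant f >].

Let lc_subring : subring_closed locally_constant_pred.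
Proof.
split=> [|f g /asboolP lf /asboolP lg|f g /asboolP lf /asboolP lg];
    apply/asboolP => x; first exact: nearW.
- apply: filterS2 (lf x) (lg x) => y fy gy.
  exact: (f_equal2 (fun a b => a - b) fy gy).
- apply: filterS2 (lf x) (lg x) => y fy gy.
  exact: (f_equal2 (fun a b => a * b) fy gy).
Qed.

(* The algebra C_K(X), with pointwise operations and involution. *)
Record lcfun := LCFun {
  lcfun_val :> X -> K;
  _ : locally_constant_pred lcfun_val
}.

HB.instance Definition _ := [isSub for lcfun_val].
HB.instance Definition _ := [Choice of lcfun by <:].
HB.instance Definition _ :=
  GRing.SubChoice_isSubComPzRing.Build (X -> K) locally_constant_pred lcfun
    lc_subring.

Lemma lcfunP (f g : lcfun) : f =1 g -> f = g.
Proof. by move=> e; apply/val_inj/funext. Qed.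

Lemma lcfun_lc (f : lcfun) : locally_constant f.
Proof. by case: f => f /= /asboolP. Qed.

Definition mklc (f : X -> K) (lf : locally_constant f) : lcfun :=
  LCFun (asboolT lf : locally_constant_pred f).

Lemma lc_comp (f : lcfun) (h : K -> K) : locally_constant (h \o f).
Proof. by move=> x /=; apply: filterS (lcfun_lc f x) => y ->. Qed.

Definition lc_star (f : lcfun) : lcfun := mklc (lc_comp f star).

Let lc_starK : involutive lc_star.
Proof. by move=> f; apply: lcfunP => x /=; rewrite starK. Qed.
Let lc_starD : {morph lc_star : f g / f + g}.
Proof. by move=> f g; apply: lcfunP => x; exact: starD. Qed.
Let lc_starM (f g : lcfun) : lc_star (f * g) = lc_star g * lc_star f.
Proof. by apply: lcfunP => x; exact: starM. Qed.

HB.instance Definition _ := isStarRing.Build lcfun lc_starK lc_starD lc_starM.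

Lemma indic_lc (U : set X) : clopen U -> locally_constant (\1_U : X -> K).
Proof.
move=> [oU cU] x; have [xU|xU] := pselect (U x).
  have : \forall y \near x, U y by exact: open_nbhs_nbhs.
  by apply: filterS => y yU; rewrite !indicE !mem_set.
have : \forall y \near x, (~` U) y.
  by apply: open_nbhs_nbhs; split=> //; exact: closed_openC.
by apply: filterS => y yU; rewrite !indicE !memNset.
Qed.

End LocallyConstant.

Record homeo (X : topologicalType) := Homeo {
  homeo_fun :> X -> X;
  homeo_inv : X -> X;
  homeo_funK : cancel homeo_fun homeo_inv;
  homeo_invK : cancel homeo_inv homeo_fun;
  homeo_cont : continuous homeo_fun;
  homeo_inv_cont : continuous homeo_inv
}.

Section HomeoAut.
Variables (X : topologicalType) (K : starFieldType) (T : homeo X).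

Let lc_precomp (f : lcfun X K) (S : X -> X) :
  continuous S -> locally_constant (f \o S).
Proof. by move=> cS x; exact: (cS x _ (lcfun_lc f (S x))). Qed.

Definition homeo_act (f : lcfun X K) : lcfun X K :=
  mklc (lc_precomp f (@homeo_inv_cont _ T)).
Definition homeo_actV (f : lcfun X K) : lcfun X K :=
  mklc (lc_precomp f (@homeo_cont _ T)).

Let actK : cancel homeo_act homeo_actV.
Proof. by move=> f; apply: lcfunP => x /=; rewrite homeo_funK. Qed.
Let actVK : cancel homeo_actV homeo_act.
Proof. by move=> f; apply: lcfunP => x /=; rewrite homeo_invK. Qed.
Let actD : {morph homeo_act : f g / f + g}.
Proof. by move=> f g; exact: lcfunP. Qed.
Let actM : {morph homeo_act : f g / f * g}.
Proof. by move=> f g; exact: lcfunP. Qed.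
Let act1 : homeo_act 1 = 1.
Proof. exact: lcfunP. Qed.
Let act_star : {morph homeo_act : f / star f}.
Proof. by move=> f; exact: lcfunP. Qed.

(* f |-> f \o T^-1, which sends the characteristic function of U to that of
   T(U) *)
Definition homeo_aut : star_aut (lcfun X K) :=
  StarAut actK actVK actD actM act1 act_star.

End HomeoAut.

(* The sequence (n_i) is indexed by i = 0, 1, 2, ... *)
Record odometer_base := OdometerBase {
  base :> nat -> nat;
  base_ge2 : forall i, (2 <= base i)%N
}.

Section Digit.
Variable n : odometer_base.

Definition digit (i : nat) : Type := discrete_topology 'I_(n i).

Let base_gt0 i : (0 < n i)%N. Proof. exact: ltnW (base_ge2 n i). Qed.

HB.instance Definition _ i := DiscreteTopology.on (digit i).
HB.instance Definition _ i := isPointed.Build (digit i) (Ordinal (base_gt0 i)).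

End Digit.

Definition digit_product (n : odometer_base) : Type := prod_topology (digit n).

HB.instance Definition _ n := Topological.on (digit_product n).
HB.instance Definition _ n := Pointed.on (digit_product n).

Definition odometer_space (n : odometer_base) : ptopologicalType :=
  digit_product n.

Notation odometer_borel n := (g_sigma_algebraType (@open (odometer_space n))).

Section Odometer.
Variable n : odometer_base.
Notation X := (odometer_space n).
Implicit Types x : X.

Definition max_digits x i := all (fun j => (x j : 'I_(n j)).+1 == n j) (iota 0 i).
Definition zero_digits x i := all (fun j => (x j : 'I_(n j)) == 0%N :> nat) (iota 0 i).

(* The i-th digit is incremented modulo n_i when all the previous digits are
   maximal, and is left unchanged otherwise. *)
Definition odometer x : X := fun i =>
  if max_digits x i then ordS (x i : 'I_(n i)) else x i.

Definition odometer_inv x : X := fun i =>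
  if zero_digits x i then ord_pred (x i : 'I_(n i)) else x i.

Let all_iotaS (p : pred nat) i :
  all p (iota 0 i.+1) = all p (iota 0 i) && p i.
Proof. by rewrite -addn1 iotaD all_cat /= andbT. Qed.

Let ordS_eq0 m (k : 'I_m) : (ordS k == 0%N :> nat) = (k.+1 == m).
Proof.
rewrite /=; have := ltn_ord k; rewrite leq_eqVlt => /orP[/eqP e|lt].
  by rewrite e modnn !eqxx.
by rewrite modn_small // (ltn_eqF lt).
Qed.

Let ord_pred_max m (k : 'I_m) : ((ord_pred k).+1 == m) = (k == 0%N :> nat).
Proof. by rewrite -ordS_eq0 ord_predK. Qed.

Lemma odometer_digits x i : zero_digits (odometer x) i = max_digits x i.
Proof.
elim: i => // i IH; rewrite /zero_digits /max_digits !all_iotaS.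
rewrite -/(zero_digits _ _) -/(max_digits _ _) IH.
by case E: (max_digits x i) => //=; rewrite /odometer E -ordS_eq0.
Qed.

Lemma odometer_inv_digits x i : max_digits (odometer_inv x) i = zero_digits x i.
Proof.
elim: i => // i IH; rewrite /zero_digits /max_digits !all_iotaS.
rewrite -/(zero_digits _ _) -/(max_digits _ _) IH.
by case E: (zero_digits x i) => //=; rewrite /odometer_inv E ord_pred_max.
Qed.

Let odometerK : cancel odometer odometer_inv.
Proof.
move=> x; apply: functional_extensionality_dep => i.
rewrite /odometer_inv odometer_digits /odometer.
by case: (max_digits x i) => //; exact: ordSK.
Qed.

Let odometer_invK : cancel odometer_inv odometer.
Proof.
move=> x; apply: functional_extensionality_dep => i.
rewrite /odometer odometer_inv_digits /odometer_inv.
by case: (zero_digits x i) => //; exact: ord_predK.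
Qed.

Lemma near_digits x N :
  \forall y \near x, forall i, (i < N)%N -> (y : X) i = x i.
Proof.
elim: N => [|N IH]; first by apply: (nearW _ (F := nbhs x)).
have xN : \forall y \near x, (y : X) N = x N.
  have := @proj_continuous _ (digit n) N x.
  by move=> /(_ [set x N]); apply; exact: discrete_set1.
near=> y => i; rewrite ltnS leq_eqVlt => /orP[/eqP->|]; first by near: y.
by move: i; near: y.
Unshelve. all: by end_near. Qed.

Let prefix_continuous (S : X -> X) :
  (forall x y i, (forall j, (j < i.+1)%N -> y j = x j) -> S y i = S x i) ->
  continuous S.
Proof.
move=> HS x.
have Fx : Filter (nbhs x) by exact: nbhs_filter.
apply/cvg_sup => i U [B [[W oW <-] /= WSx] BU].
have := near_digits x i.+1; apply: filterS => y xy.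
by apply: BU; rewrite /= (HS x).
Qed.

Let odometer_cont : continuous odometer.
Proof.
apply: prefix_continuous => x y i xy; rewrite /odometer (xy i) //.
rewrite (_ : max_digits y i = max_digits x i) //.
by apply: eq_in_all => j; rewrite mem_iota => /= ji; rewrite xy // ltnW.
Qed.

Let odometer_inv_cont : continuous odometer_inv.
Proof.
apply: prefix_continuous => x y i xy; rewrite /odometer_inv (xy i) //.
rewrite (_ : zero_digits y i = zero_digits x i) //.
by apply: eq_in_all => j; rewrite mem_iota => /= ji; rewrite xy // ltnW.
Qed.

Definition odometer_homeo : homeo X :=
  Homeo odometerK odometer_invK odometer_cont odometer_inv_cont.

(* The product of the uniform probability measures on the sets of digits is the
   probability measure with these values on measurable rectangles. *)
Definition uniform_product (R : realType) (mu : set X -> \bar R) :=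
  forall (N : nat) (A : forall i, {set 'I_(n i)}),
    mu [set x | forall i, (i < N)%N -> (x i : 'I_(n i)) \in A i] =
    (\prod_(i < N) (#|A i|%:R / (n i)%:R))%:E.

Definition Zn : set rat :=
  [set q | exists (a : int) (r : nat), q = a%:~R / (\prod_(i < r.+1) n i)%N%:R].

Definition Zn_nneg : set rat := [set q | Zn q /\ 0 <= q].

End Odometer.

Notation odometer_alg K n := (crossed (homeo_aut K (odometer_homeo n))).

Definition chi (K : starFieldType) (n : odometer_base)
    (U : set (odometer_space n)) (cU : clopen U) : odometer_alg K n :=
  crossed_const _ (mklc (indic_lc K cU)).

Lemma gen_chi (K : starFieldType) (n : odometer_base)
    (U : set (odometer_space n)) (cU : clopen U)
    (cTU : clopen (odometer_homeo n @` U)) :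
  crossed_gen _ * chi K cU = chi K cTU * crossed_gen _.
Proof.
rewrite /chi [LHS]crossed_genE; congr (crossed_const _ _ * _).
apply: lcfunP => x /=; rewrite /homeo_act /= !indicE; congr ((_ : bool)%:R).
apply/idP/idP; rewrite !inE.
  by move=> Ux; exists (homeo_inv (odometer_homeo n) x) => //;
    exact: (homeo_invK (odometer_homeo n) x).
by move=> [y Uy <-]; have /= -> := homeo_funK (odometer_homeo n) y.
Qed.

Definition matrix_fun (A : pzRingType) (R : Type) : Type :=
  forall p q : nat, 'M[A]_(p, q) -> R.

Record sylvester_rank (R : realType) (A : pzRingType) (rk : matrix_fun A R) :
    Prop := SylvesterRank {
  rk_ge0 : forall p q (M : 'M[A]_(p, q)), 0 <= rk p q M;
  rk_mx0 : forall p q, rk p q 0 = 0;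
  rk_one : rk 1%N 1%N 1%:M = 1;
  rk_mul : forall p q r (M1 : 'M[A]_(p, q)) (M2 : 'M[A]_(q, r)),
    rk p r (M1 *m M2) <= Num.min (rk p q M1) (rk q r M2);
  rk_diag : forall p1 q1 p2 q2 (M1 : 'M[A]_(p1, q1)) (M2 : 'M[A]_(p2, q2)),
    rk (p1 + p2)%N (q1 + q2)%N (block_mx M1 0 0 M2) = rk p1 q1 M1 + rk p2 q2 M2;
  rk_utri : forall p1 q1 p2 q2 (M1 : 'M[A]_(p1, q1)) (M2 : 'M[A]_(p2, q2))
      (M3 : 'M[A]_(p1, q2)),
    rk p1 q1 M1 + rk p2 q2 M2 <= rk (p1 + p2)%N (q1 + q2)%N (block_mx M1 M3 0 M2)
}.

Definition elt_rank (R : realType) (A : pzRingType) (rk : matrix_fun A R)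
  (x : A) : R := rk 1%N 1%N x%:M.

Definition rank_dist (R : realType) (A : pzRingType) (rk : matrix_fun A R)
  (x y : A) : R := elt_rank rk (x - y).

(* [B], with its rank function [rkB], is the completion of the *-ring [A] for
   the metric rank_dist rkA: a complete metric *-ring, with continuous
   involution, in which [A] maps densely and isometrically by [iota], and whose
   rank function extends that of [A].  These conditions determine
   (B, rkB, iota) up to a unique isomorphism. *)
Record rank_completion (R : realType) (A B : starRingType)
    (rkA : matrix_fun A R) (rkB : matrix_fun B R) (iota : {rmorphism A -> B}) :
    Prop := RankCompletion {
  completion_sylvester : sylvester_rank rkB;
  completion_extends :
    forall p q (M : 'M[A]_(p, q)), rkB p q (map_mx iota M) = rkA p q M;
  completion_star : forall a, iota (star a) = star (iota a);
  completion_star_cont : forall (x : B) (e : R), 0 < e ->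
    exists2 d : R, 0 < d &
      forall y, rank_dist rkB x y < d -> rank_dist rkB (star x) (star y) < e;
  completion_separated : forall x y : B, rank_dist rkB x y = 0 -> x = y;
  completion_dense : forall (x : B) (e : R), 0 < e ->
    exists a, rank_dist rkB x (iota a) < e;
  completion_complete : forall u : nat -> B,
    (forall e : R, 0 < e -> exists N, forall i j, (N <= i)%N -> (N <= j)%N ->
       rank_dist rkB (u i) (u j) < e) ->
    exists l, forall e : R, 0 < e -> exists N, forall i, (N <= i)%N ->
       rank_dist rkB (u i) l < e
}.

(* [D] is a unital *-subring of [B] and, as a ring, *-regular. *)
Record star_regular_subring (B : starRingType) (D : set B) : Prop :=
  StarRegularSubring {
  srs_one : D 1;
  srs_sub : forall x y, D x -> D y -> D (x - y);
  srs_mul : forall x y, D x -> D y -> D (x * y);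
  srs_star : forall x, D x -> D (star x);
  srs_regular : forall x, D x -> exists2 y, D y & x * y * x = x;
  srs_proper : forall x, D x -> star x * x = 0 -> x = 0
}.

(* The intersection of all *-regular subrings containing [S].  If [B] is
   *-regular it is itself *-regular, since the relative inverse y of x (x y and
   y x self-adjoint, x y x = x, y x y = y) then exists in each of these subrings
   and is unique in [B]. *)
Definition star_regular_closure (B : starRingType) (S : set B) : set B :=
  smallest (@star_regular_subring B) S.

Definition rank_values (R : realType) (A : pzRingType) (rk : matrix_fun A R)
    (D : set A) : set R :=
  [set r | exists (k : nat) (M : 'M[A]_k),
     [/\ (1 <= k)%N, forall i j, D (M i j) & r = rk k k M]].

Definition betti_values (R : realType) (A : pzRingType) (rk : matrix_fun A R) :
    set R :=
  [set r | exists (k : nat) (M : 'M[A]_k), (1 <= k)%N /\ r = k%:R - rk k k M].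

Definition additive_subgroup (V : zmodType) (H : set V) : Prop :=
  H 0 /\ forall x y, H x -> H y -> H (x - y).

Definition generated_subgroup (V : zmodType) (S : set V) : set V :=
  smallest (@additive_subgroup V) S.

(* Main.v *)
From HB Require Import structures.
Require Import Defs.
From mathcomp Require Import all_boot all_order all_algebra.
From mathcomp Require Import finmap.
From mathcomp Require Import all_classical all_reals all_analysis.

Set Implicit Arguments.
Unset Strict Implicit.
Unset Printing Implicit Defensive.

Import Order.TTheory GRing.Theory Num.Theory.
Local Open Scope classical_set_scope.
Local Open Scope ring_scope.

(** Write N_m = n_0 ... n_m, and let E_m be the cylinder on which the digits
    0, ..., m vanish.  The sets E_m, T E_m, ..., T^(N_m - 1) E_m partition X, and
    T^N_m maps E_m onto itself: a Rokhlin tower without error.  With e the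
    projection of E_m, the elements t^i e t^-j (i, j < N_m) are matrix units
    commuting with K and with t^N_m, and the subalgebra of the odometer algebra
    generated by t and by the functions of the first m + 1 digits is the algebra of
    N_m x N_m matrices over the Laurent polynomials in s = t^N_m.

    In the completion every nonzero polynomial in t is invertible
    ([poly_invertible]).  Indeed deleting from t its last step up the tower gives
    an element u with u^N_m = 0 and rk (t - u) <= 1 / N_m; if q(0) <> 0 then q(u)
    is invertible since u is nilpotent, q(u) tends to q(t) in rank, and in a
    complete ring a rank limit of invertible elements is invertible
    ([invertible_of_rank_limit]).  So the matrices over the field K(s) embed in the
    completion, as the ring D_m of all x with e t^-i x t^j e in e K(s) for
    i, j < N_m ([tower_ring]).

    Matrices over a field form a regular ring, and D_m inherits this.  It is
    closed under the involution, as s is unitary.  It is proper because K(s) is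
    positive definite: after clearing denominators, the constant term of a sum of
    elements star p * p with p in K[s] is a sum of elements star c * c with c in K
    ([psi_positive]).  Gaussian elimination over K(s) makes the rank of a matrix
    over D_m an integer multiple of rk e = mu(E_m) = 1 / N_m ([rk_corner],
    [tower_ring_rank]).  The D_m increase, and by compactness of X their union
    contains the odometer algebra.  That union is *-regular, so it contains the
    *-regular closure, and all the values considered lie in Z(n)^+.

    Conversely a / N_m is the rank of the scalar matrix e of size a, and it is
    the Betti number of the scalar matrix 1 - e of the same size. *)

Local Notation "x %:F" := (@FracField.tofrac _ x).

(** * Invertible elements *)
Definition invertible (A : pzRingType) (x : A) : Prop :=
  exists y, x * y = 1 /\ y * x = 1.

Lemma invertibleM (A : pzRingType) (x y : A) :
  invertible x -> invertible y -> invertible (x * y).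
Proof.
move=> [x' [xx' x'x]] [y' [yy' y'y]]; exists (y' * x'); split.
  by rewrite mulrA -(mulrA x) yy' mulr1.
by rewrite mulrA -(mulrA y') x'x mulr1.
Qed.

Lemma invertibleX (A : pzRingType) (x : A) k : invertible x -> invertible (x ^+ k).
Proof.
move=> ix; elim: k => [|k IH]; first by exists 1; rewrite expr0 mulr1.
by rewrite exprS; apply: invertibleM.
Qed.

Lemma expr_inverse (A : pzRingType) (x y : A) k :
  x * y = 1 -> x ^+ k * y ^+ k = 1.
Proof.
move=> xy; elim: k => [|k IH]; first by rewrite !expr0 mulr1.
by rewrite exprSr exprS mulrA -(mulrA _ x) xy mulr1.
Qed.

Lemma comm_inverse (A : pzRingType) (a b c : A) :
  b * c = 1 -> c * b = 1 -> a * b = b * a -> a * c = c * a.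
Proof.
by move=> bc cb ab; rewrite -[LHS]mul1r -cb -mulrA (mulrA b) -ab -!mulrA bc mulr1.
Qed.

(** * Sylvester rank functions *)
Section SylvesterRank.
Variables (R : realType) (A : pzRingType) (rk : matrix_fun A R).
Hypothesis rkS : sylvester_rank rk.

Lemma rk_mull p q r (M1 : 'M[A]_(p, q)) (M2 : 'M[A]_(q, r)) :
  rk (M1 *m M2) <= rk M1.
Proof. by have := rk_mul rkS M1 M2; rewrite le_min => /andP[]. Qed.

Lemma rk_mulr p q r (M1 : 'M[A]_(p, q)) (M2 : 'M[A]_(q, r)) :
  rk (M1 *m M2) <= rk M2.
Proof. by have := rk_mul rkS M1 M2; rewrite le_min => /andP[]. Qed.

Lemma rk_sandwich p q r s (L : 'M[A]_(p, q)) (M : 'M[A]_(q, r)) (N : 'M[A]_(r, s)) :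
  rk (L *m M *m N) <= rk M.
Proof. exact: le_trans (rk_mull _ _) (rk_mulr _ _). Qed.

(** M1 + M2 is a compression of the block diagonal matrix of M1 and M2. *)
Lemma rk_addM p q (M1 M2 : 'M[A]_(p, q)) : rk (M1 + M2) <= rk M1 + rk M2.
Proof.
rewrite -(rk_diag rkS).
have -> : M1 + M2 = row_mx 1%:M 1%:M *m block_mx M1 0 0 M2 *m col_mx 1%:M 1%:M.
  rewrite mul_row_block !mul1mx addr0 add0r mul_row_col.
  by rewrite !mulmx1.
exact: rk_sandwich.
Qed.

Lemma rk_scalar k (x : A) : rk (x%:M : 'M[A]_k) = k%:R * elt_rank rk x.
Proof.
elim: k => [|k IH]; first by rewrite [_%:M]flatmx0 (rk_mx0 rkS) mul0r.
change (rk (x%:M : 'M[A]_(1 + k)) = k.+1%:R * elt_rank rk x).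
by rewrite scalar_mx_block (rk_diag rkS) IH -[in RHS]add1n natrD mulrDl mul1r.
Qed.

Lemma elt_rank1 : elt_rank rk 1 = 1. Proof. exact: rk_one rkS. Qed.

Lemma elt_rank0 : elt_rank rk 0 = 0.
Proof. by rewrite /elt_rank raddf0 (rk_mx0 rkS). Qed.

Lemma elt_rank_ge0 x : 0 <= elt_rank rk x. Proof. exact: rk_ge0 rkS _ _ _. Qed.

(** The ring is not assumed nontrivial; the normalization of the rank forces it. *)
Lemma one_neq0 : (1 : A) <> 0.
Proof. by move=> e; have := elt_rank1; rewrite e elt_rank0 => /esym/eqP; rewrite oner_eq0. Qed.

Lemma rk_le_size k l (M : 'M[A]_(k, l)) : rk M <= k%:R.
Proof.
have -> : k%:R = rk (1%:M : 'M[A]_k) by rewrite rk_scalar elt_rank1 mulr1.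
by rewrite -[M]mul1mx; exact: rk_mull.
Qed.

Lemma elt_rank_mull x y : elt_rank rk (x * y) <= elt_rank rk x.
Proof. by rewrite /elt_rank scalar_mxM; exact: rk_mull. Qed.

Lemma elt_rank_mulr x y : elt_rank rk (x * y) <= elt_rank rk y.
Proof. by rewrite /elt_rank scalar_mxM; exact: rk_mulr. Qed.

Lemma elt_rankD x y : elt_rank rk (x + y) <= elt_rank rk x + elt_rank rk y.
Proof. by rewrite /elt_rank raddfD; exact: rk_addM. Qed.

Lemma elt_rankN x : elt_rank rk (- x) = elt_rank rk x.
Proof.
have le y : elt_rank rk (- y) <= elt_rank rk y.
  by rewrite -mulN1r elt_rank_mulr.
by apply/eqP; rewrite eq_le le /= -{1}[x]opprK le.
Qed.

End SylvesterRank.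

(** * Limits of invertible elements *)
Section RankCompletion.
Variables (R : realType) (A B : starRingType).
Variables (rkA : matrix_fun A R) (rkB : matrix_fun B R) (iota : {rmorphism A -> B}).
Hypothesis compl : rank_completion rkA rkB iota.
Let rkS := completion_sylvester compl.
Local Notation rk1 := (elt_rank rkB).

Lemma eq_of_small_rank (x y : B) :
  (forall e : R, 0 < e -> rk1 (x - y) < e) -> x = y.
Proof.
move=> h; apply: (completion_separated compl); apply/eqP.
rewrite eq_le elt_rank_ge0 // andbT leNgt; apply/negP => /h.
by rewrite ltxx.
Qed.

(** If z is inverse to y, z' to y' and y, y' are close to x, then
    z - z' = z (y' - y) z' has small rank, whatever the inverses are: the rank is
    bounded by that of any factor.  So the inverses of a sequence tending to x form
    a Cauchy sequence, and their limit inverts x. *)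
Lemma invertible_of_rank_limit (x : B) :
  (forall e : R, 0 < e -> exists y, invertible y /\ rk1 (x - y) < e) ->
  invertible x.
Proof.
move=> happr.
have hx k : exists z : B * B, [/\ z.1 * z.2 = 1, z.2 * z.1 = 1 & rk1 (x - z.1) < k.+1%:R^-1].
  have [|y [[z [yz zy]] lt]] := happr (k.+1%:R^-1); first by rewrite invr_gt0.
  by exists (y, z).
have [z hz] := boolp.choice hx.
have small (e : R) : 0 < e -> exists N, forall i, (N <= i)%N -> rk1 (x - (z i).1) < e.
  move=> e0; have [N _ hN] := near_infty_natSinv_lt (PosNum e0).
  exists N => i Ni; have [_ _] := hz i => /lt_trans; apply; exact: hN.
have cauchy : forall e : R, 0 < e -> exists N, forall i j, (N <= i)%N -> (N <= j)%N ->
    rank_dist rkB (z i).2 (z j).2 < e.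
  move=> e e0; have [|N hN] := small (e / 2); first by rewrite divr_gt0.
  exists N => i j Ni Nj; rewrite /rank_dist.
  have -> : (z i).2 - (z j).2 = (z i).2 * ((x - (z i).1) - (x - (z j).1)) * (z j).2.
    have -> : (x - (z i).1) - (x - (z j).1) = (z j).1 - (z i).1.
      by rewrite opprB addrC addrA subrK.
    have [_ e2 _] := hz i; have [e1 _ _] := hz j.
    by rewrite mulrBr mulrBl e2 mul1r -mulrA e1 mulr1.
  apply: le_lt_trans (elt_rank_mull rkS _ _) _.
  apply: le_lt_trans (elt_rank_mulr rkS _ _) _.
  apply: le_lt_trans (elt_rankD rkS _ _) _.
  by rewrite elt_rankN // [e]splitr; apply: ltrD; apply: hN.
have [l hl] := completion_complete compl cauchy.
have close (e : R) : 0 < e -> exists i, rk1 (x - (z i).1) < e / 2 /\ rk1 (l - (z i).2) < e / 2.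
  move=> e0; have e20 : 0 < e / 2 by rewrite divr_gt0.
  have [N hN] := small _ e20; have [N' hN'] := hl _ e20.
  exists (maxn N N'); rewrite hN ?leq_maxl //; split=> //.
  have := hN' _ (leq_maxr N N'); rewrite /rank_dist -elt_rankN // opprB //.
exists l; split; apply: eq_of_small_rank => e e0.
  have [i [hx1 hx2]] := close e e0; have [e1 e2 _] := hz i.
  have -> : x * l - 1 = x * (l - (z i).2) + (x - (z i).1) * (z i).2.
    by rewrite mulrBr mulrBl e1 addrA subrK.
  apply: le_lt_trans (elt_rankD rkS _ _) _; rewrite [e]splitr ltrD //.
    exact: le_lt_trans (elt_rank_mulr rkS _ _) _.
  exact: le_lt_trans (elt_rank_mull rkS _ _) _.
have [i [hx1 hx2]] := close e e0; have [e1 e2 _] := hz i.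
have -> : l * x - 1 = (l - (z i).2) * x + (z i).2 * (x - (z i).1).
  by rewrite mulrBr mulrBl e2 addrA subrK.
apply: le_lt_trans (elt_rankD rkS _ _) _; rewrite [e]splitr ltrD //.
  exact: le_lt_trans (elt_rank_mull rkS _ _) _.
exact: le_lt_trans (elt_rank_mulr rkS _ _) _.
Qed.

End RankCompletion.

(** * Extension of ring morphisms to polynomials and fractions *)
(** For functions that are only constructed in the course of a proof. *)
Lemma pack_rmorphism (A B : pzRingType) (f : A -> B) :
  {morph f : x y / x - y} -> f 1 = 1 -> {morph f : x y / x * y} ->
  exists g : {rmorphism A -> B}, g =1 f.
Proof.
move=> fB f1 fM.
pose a := GRing.isZmodMorphism.Build A B f fB.
pose m := GRing.isMonoidMorphism.Build A B f (conj f1 fM).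
pose g : {rmorphism A -> B} := HB.pack f a m.
by exists g.
Qed.

(** Evaluation at u, defined from the coefficients: mapping a polynomial to one over
    B first would require 1 <> 0 in B. *)
Lemma poly_lift (K : nzRingType) (B : pzRingType) (kappa : {rmorphism K -> B})
    (u : B) : (forall c, kappa c * u = u * kappa c) ->
  exists ev : {rmorphism {poly K} -> B},
    (forall c, ev c%:P = kappa c) /\ ev 'X = u.
Proof.
move=> ku; pose f (p : {poly K}) := \sum_(i < size p) kappa p`_i * u ^+ i.
have fw (p : {poly K}) n : (size p <= n)%N -> f p = \sum_(i < n) kappa p`_i * u ^+ i.
  move=> le; rewrite /f (big_ord_widen n (fun i => kappa p`_i * u ^+ i) le).
  rewrite big_mkcond; apply: eq_bigr => i _; case: ifP => // /negbT.
  by rewrite -leqNgt => /(nth_default 0) ->; rewrite rmorph0 mul0r.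
have fC c : f c%:P = kappa c.
  rewrite (fw _ 1%N) ?size_polyC_leq1 // big_ord1 coefC eqxx expr0 mulr1 //.
have fD : {morph f : p q / p + q}.
  move=> p q; pose n := maxn (size p) (size q).
  rewrite (fw (p + q) n) ?size_polyD // (fw p n) ?leq_maxl // (fw q n) ?leq_maxr //.
  by rewrite -big_split; apply: eq_bigr => i _; rewrite coefD rmorphD mulrDl.
have f0 : f 0 = 0 by rewrite -[0](polyC0 K) fC rmorph0.
have fX (p : {poly K}) : f (p * 'X) = f p * u.
  have le : (size (p * 'X)%R <= (size p).+1)%N.
    by rewrite (leq_trans (size_polyMleq _ _)) // size_polyX addn2.
  rewrite (fw _ _ le) big_ord_recl coefMX /= rmorph0 mul0r add0r /f mulr_suml.
  by apply: eq_bigr => i _; rewrite coefMX /= exprSr mulrA.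
have fM : {morph f : p q / p * q}.
  move=> p; elim/poly_ind => [|q c IH]; first by rewrite f0 !mulr0 f0.
  rewrite mulrDr mulrA !fD !fX IH fC mulrDr mulrA; congr (_ + _).
  elim/poly_ind: p {IH} => [|p d IH]; first by rewrite f0 !mul0r f0.
  rewrite mulrDl fD -mulrA (_ : 'X * c%:P = c%:P * 'X); last exact/esym/commr_polyX.
  by rewrite mulrA fX IH fD fX mulrDl -polyCM !fC rmorphM -!mulrA ku.
have fN (p : {poly K}) : f (- p) = - f p.
  by apply: (addrI (f p)); rewrite -fD !subrr f0.
have fB : {morph f : p q / p - q} by move=> p q; rewrite fD fN.
have f1 : f 1 = 1 by rewrite -[1](polyC1 K) fC rmorph1.
have [g gf] := pack_rmorphism fB f1 fM.
exists g; split=> [c|]; first by rewrite gf fC.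
by rewrite gf -['X]mul1r fX f1 mul1r.
Qed.

Lemma fraction_numden (R : idomainType) (x : {fraction R}) :
  exists n d : R, d != 0 /\ x = n%:F / d%:F.
Proof.
elim/quotW: x => x; exists (frac x).1, (frac x).2.
split; first exact: denom_ratioP.
unlock FracField.tofrac; rewrite -[X in _ * X]FracField.pi_inv.
rewrite -[RHS]FracField.pi_mul -[in LHS](Ratio_numden x).
have [num1 den1] := (fun y : R => numer_Ratio y (oner_neq0 R), fun y : R => denom_Ratio y (oner_neq0 R)).
rewrite /FracField.mulf /FracField.invf !num1 !den1.
by rewrite !numden_Ratio ?denom_ratioP // mulr1 mul1r.
Qed.

(** Universal property of the field of fractions.  The target need not be
    commutative, but the image of f is, and so are the inverses of its elements
    ([comm_inverse]). *)
Lemma fraction_lift (R : idomainType) (B : pzRingType) (f : {rmorphism R -> B}) :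
  (forall x, x != 0 -> invertible (f x)) ->
  exists g : {rmorphism {fraction R} -> B}, forall x, g x%:F = f x.
Proof.
move=> fV.
have /boolp.choice[inv invP] : forall x, exists y, x != 0 -> f x * y = 1 /\ y * f x = 1.
  move=> x; have [->|/fV[y hy]] := eqVneq x 0; first by exists 0.
  by exists y.
have /boolp.choice[num /boolp.choice[den nd]] := @fraction_numden R.
have fc y z : f y * f z = f z * f y by rewrite -!rmorphM mulrC.
pose h x := f (num x) * inv (den x).
(* h does not depend on the choice of a numerator and a denominator *)
have hE x n d : d != 0 -> x = n%:F / d%:F -> h x = f n * inv d.
  move=> d0 xE; have [D0 xE'] := nd x; rewrite /h.
  have /eqP : n%:F * (den x)%:F = (num x)%:F * d%:F.
    apply/eqP; rewrite -eqr_div ?tofrac_eq0 //; first by rewrite -xE -xE'.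
  rewrite -!tofracM tofrac_eq => /eqP e.
  have [d1 d2] := invP _ d0; have [D1 D2] := invP _ D0.
  have fI y : f y * inv (den x) = inv (den x) * f y by exact: comm_inverse D1 D2 (fc _ _).
  rewrite -[f n]mulr1 -D1 mulrA -rmorphM e rmorphM -!mulrA (mulrA (f d)) (fI d).
  by rewrite -!mulrA d1 mulr1.
have hn x : exists n d, [/\ d != 0, x = n%:F / d%:F & h x = f n * inv d].
  by exists (num x), (den x); have [d0 xE] := nd x.
have hM : {morph h : x y / x * y}.
  move=> x y; have [n [d [d0 xE ->]]] := hn x; have [m [c [c0 yE ->]]] := hn y.
  have dc0 : d * c != 0 by rewrite mulf_neq0.
  rewrite (@hE _ (n * m) (d * c)) //; last first.
    by rewrite xE yE !tofracM mulf_div.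
  have [e1 e2] := invP _ d0; have [e3 e4] := invP _ c0; have [e5 e6] := invP _ dc0.
  have -> : inv (d * c) = inv c * inv d.
    rewrite -[LHS]mulr1 -e1 -(mulr1 (f d)) -e3 -!mulrA (mulrA (f d)) -rmorphM mulrA e6 mul1r //.
  have -> : f (n * m) = f n * f m by rewrite rmorphM.
  have fI y' : f y' * inv d = inv d * f y' by exact: comm_inverse e1 e2 (fc _ _).
  have -> : inv c * inv d = inv d * inv c by apply/esym/(comm_inverse e3 e4)/esym/fI.
  by rewrite -!mulrA (mulrA (f m)) (fI m) -!mulrA.
have hF x : h x%:F = f x.
  rewrite (@hE _ x 1) ?oner_neq0 // ?tofrac1 ?divr1 //.
  by have [] := invP _ (oner_neq0 R); rewrite rmorph1 mul1r => -> _; rewrite mulr1.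
have hB : {morph h : x y / x - y}.
  move=> x y; have [n [d [d0 xE _]]] := hn x; have [m [c [c0 yE _]]] := hn y.
  have dc0 : d * c != 0 by rewrite mulf_neq0.
  rewrite (@hE x (n * c) (d * c)) ?(@hE y (m * d) (d * c)) //; last 2 first.
  - by rewrite yE !tofracM [_%:F * d%:F]mulrC -mulf_div divff ?mul1r ?tofrac_eq0.
  - by rewrite xE !tofracM -mulf_div divff ?mulr1 ?tofrac_eq0.
  rewrite (@hE _ (n * c - m * d) (d * c)) //; first by rewrite rmorphB mulrBl.
  by rewrite xE yE tofracB !tofracM -mulNr addf_div ?tofrac_eq0 // mulNr.
have [g gh] := pack_rmorphism hB (etrans (hF 1) (rmorph1 f)) hM.
by exists g => x; rewrite gh hF.
Qed.

(** * Rokhlin towers and their matrix units *)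
(** Col and Row exhibit M as equivalent, in the corner cut out by eps, to the matrix
    A over the field F, so M and eps A have the same rank.  Factoring A as U V with
    U left invertible and V right invertible, of inner dimension r = rank A, shows
    that eps A has the rank of the scalar matrix eps of size r. *)
Lemma rk_corner (R : realType) (B : pzRingType) (rk : matrix_fun B R)
    (F : fieldType) (psi : {rmorphism F -> B}) (eps : B) k p
    (Row : 'M[B]_(k, p)) (Col : 'M[B]_(p, k)) (M : 'M[B]_k) (A : 'M[F]_p) :
  sylvester_rank rk -> (forall f, psi f * eps = eps * psi f) ->
  Row *m Col = 1%:M -> Col *m Row = eps%:M ->
  Col *m M *m Row = eps%:M *m map_mx psi A ->
  rk _ _ M = (\rank A)%:R * elt_rank rk eps.
Proof.
move=> rkS psieps RC CR CMR.
have comm q r (L : 'M[F]_(q, r)) : eps%:M *m map_mx psi L = map_mx psi L *m eps%:M.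
  rewrite mul_scalar_mx; apply/matrixP => i j; rewrite !mxE (bigD1 j) //= big1.
    by rewrite !mxE eqxx addr0 mulr1n psieps.
  by move=> l /negPf lj; rewrite !mxE lj mulr0n mulr0.
have -> : rk _ _ M = rk _ _ (eps%:M *m map_mx psi A).
  apply/eqP; rewrite eq_le -CMR rk_sandwich // andbT.
  have E : Row *m (Col *m M *m Row) *m Col = M.
    by rewrite -!mulmxA RC mulmx1 mulmxA RC mul1mx.
  by rewrite -[X in rk _ _ X <= _]E; exact: rk_sandwich.
rewrite -rk_scalar //; set r := \rank A.
pose U := col_base A; pose V := row_base A.
have AE : map_mx psi A = map_mx psi U *m map_mx psi V by rewrite -map_mxM mulmx_base.
have VV : map_mx psi V *m map_mx psi (pinvmx V) = 1%:M.
  by rewrite -map_mxM mulmxVp ?map_mx1 // row_base_free.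
have UU : map_mx psi (pinvmx U) *m map_mx psi U = 1%:M.
  by rewrite -map_mxM mulVpmx ?map_mx1 // col_base_full.
apply/eqP; rewrite eq_le; apply/andP; split.
  by rewrite AE mulmxA comm; exact: rk_sandwich.
have E : map_mx psi (pinvmx U) *m (eps%:M *m map_mx psi A) *m map_mx psi (pinvmx V)
    = eps%:M.
  rewrite AE (mulmxA eps%:M) comm -!mulmxA VV mulmx1 mulmxA UU mul1mx //.
by rewrite -[X in rk _ _ X <= _]E; exact: rk_sandwich.
Qed.

Lemma starX (B : starRingType) (x : B) k : star (x ^+ k) = star x ^+ k.
Proof.
by elim: k => [|k IH]; rewrite ?expr0 ?star1 // exprS exprSr starM IH.
Qed.
Section Tower.
Variables (B : starRingType) (t eps : B) (N : nat).

(** In the odometer algebra, t ^ i * eps * star t ^ i is the projection of the i-th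
    level of the tower; [tower_disjoint] says that the levels are disjoint and
    [tower_cover] that they fill the space. *)
Record rokhlin_tower : Prop := RokhlinTower {
  tower_proj : eps * eps = eps;
  tower_star : star eps = eps;
  tower_disjoint : forall k, (0 < k < N)%N -> eps * t ^+ k * eps = 0;
  tower_cover : \sum_(i < N) t ^+ i * eps * star t ^+ i = 1
}.

Variables (F : fieldType) (psi : {rmorphism F -> B}).

(** The (i, j) entry of x, seen as an N x N matrix over the corner eps B eps through
    the matrix units t ^ i * eps * star t ^ j. *)
Definition corner (x : B) (i j : nat) := eps * star t ^+ i * x * t ^+ j * eps.

(** The copy of the N x N matrices over F, for psi commuting with the matrix units;
    it is described by entries so as to be a subset of B. *)
Definition tower_ring : set B :=
  [set x | forall i j : 'I_N, exists f, corner x i j = eps * psi f].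

Hypothesis Kt : star t * t = 1.
Hypothesis tower : rokhlin_tower.
Let epsK := tower_proj tower.

Lemma corner_shift i j : (i <= j)%N -> star t ^+ i * t ^+ j = t ^+ (j - i).
Proof. by move=> ij; rewrite -{1}(subnKC ij) exprD mulrA expr_inverse // mul1r. Qed.

Lemma corner1 (i j : 'I_N) : corner 1 i j = if i == j then eps else 0.
Proof.
have le (a b : 'I_N) : (a <= b)%N -> corner 1 a b = if a == b then eps else 0.
  move=> ab; rewrite /corner mulr1 -(mulrA eps) corner_shift //.
  case: eqVneq => [->|ne]; first by rewrite subnn mulr1.
  apply: tower_disjoint => //; rewrite subn_gt0 ltn_neqAle ab andbT ne /=.
  exact: leq_ltn_trans (leq_subr _ _) (ltn_ord b).
have [/le //|/ltnW/le ji] := leqP i j.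
have := congr1 star ji; rewrite /corner !starM !starX !tower_star // starK star1.
by rewrite !mul1r !mulr1 !mulrA eq_sym => ->; case: ifP; rewrite ?star0 ?tower_star.
Qed.

Lemma corner_add x y i j : corner (x + y) i j = corner x i j + corner y i j.
Proof. by rewrite /corner mulrDr !mulrDl. Qed.

Lemma corner_opp x i j : corner (- x) i j = - corner x i j.
Proof. by rewrite /corner mulrN !mulNr. Qed.

Lemma corner_mul x y i j :
  corner (x * y) i j = \sum_(l < N) corner x i l * corner y l j.
Proof.
have -> : x * y = x * 1 * y by rewrite mulr1.
rewrite -(tower_cover tower) /corner !(mulr_suml, mulr_sumr).
rewrite ?(mulr_suml, mulr_sumr); apply: eq_bigr => l _.
by rewrite !mulrA -(mulrA _ eps eps) epsK.
Qed.

Lemma corner_star x i j : corner (star x) i j = star (corner x j i).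
Proof. by rewrite /corner !starM !starX !tower_star // starK !mulrA. Qed.

Lemma corner_decomp x :
  x = \sum_(i < N) \sum_(j < N) t ^+ i * corner x i j * star t ^+ j.
Proof.
rewrite -[LHS]mul1r -[LHS]mulr1 -(tower_cover tower) 2!mulr_suml.
apply: eq_bigr => i _; rewrite mulr_sumr.
by apply: eq_bigr => j _; rewrite /corner !mulrA.
Qed.

Lemma corner_inj x y : (forall i j : 'I_N, corner x i j = corner y i j) -> x = y.
Proof.
move=> e; rewrite [x]corner_decomp [y]corner_decomp.
by apply: eq_bigr => i _; apply: eq_bigr => j _; rewrite e.
Qed.

Lemma corner_sum I (r : seq I) (f : I -> B) i j :
  corner (\sum_(l <- r) f l) i j = \sum_(l <- r) corner (f l) i j.
Proof. by rewrite /corner mulr_sumr !mulr_suml. Qed.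

(** Entries can be prescribed; this provides the relative inverse of an element. *)
Lemma corner_build (b : 'I_N -> 'I_N -> B) (i j : 'I_N) :
  (forall i j, eps * b i j = b i j) -> (forall i j, b i j * eps = b i j) ->
  corner (\sum_(l < N) \sum_(m < N) t ^+ l * b l m * star t ^+ m) i j = b i j.
Proof.
move=> eb be.
have term (l m : 'I_N) : corner (t ^+ l * b l m * star t ^+ m) i j = corner 1 i l * b l m * corner 1 m j.
  by rewrite /corner !mulr1 -!mulrA (mulrA eps (b l m)) eb (mulrA (b l m) eps) be.
rewrite corner_sum (bigD1 i) //= corner_sum (bigD1 j) //= term !corner1 !eqxx eb be.
rewrite big1 ?addr0 => [|m /negPf mj]; last by rewrite term !corner1 mj mulr0.
rewrite big1 ?addr0 // => l /negPf li; rewrite corner_sum big1 // => m _.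
by rewrite term !corner1 eq_sym li !mul0r.
Qed.

Hypothesis psi_eps : forall f, psi f * eps = eps * psi f.
Hypothesis psi_t : forall f, psi f * t = t * psi f.

Lemma tower_ring1 : tower_ring 1.
Proof.
move=> i j; rewrite corner1; case: ifP => _; first by exists 1; rewrite rmorph1 mulr1.
by exists 0; rewrite rmorph0 mulr0.
Qed.

Lemma tower_ringB x y : tower_ring x -> tower_ring y -> tower_ring (x - y).
Proof.
move=> Dx Dy i j; have [f xf] := Dx i j; have [g yg] := Dy i j.
by exists (f - g); rewrite corner_add corner_opp xf yg rmorphB mulrBr.
Qed.

Lemma tower_ring_coef x : tower_ring x ->
  exists A : 'M[F]_N, forall i j : 'I_N, corner x i j = eps * psi (A i j).
Proof.
move=> Dx.
have /boolp.choice[A AP] : forall i : 'I_N, exists g : 'I_N -> F,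
    forall j : 'I_N, corner x i j = eps * psi (g j).
  by move=> i; have /boolp.choice[g gP] := Dx i; exists g.
by exists (\matrix_(i, j) A i j) => i j; rewrite mxE.
Qed.

Lemma corner_mulmx x y (A C : 'M[F]_N) :
  (forall i j : 'I_N, corner x i j = eps * psi (A i j)) ->
  (forall i j : 'I_N, corner y i j = eps * psi (C i j)) ->
  forall i j : 'I_N, corner (x * y) i j = eps * psi ((A *m C) i j).
Proof.
move=> xA yC i j; rewrite corner_mul mxE rmorph_sum mulr_sumr.
apply: eq_bigr => l _; rewrite xA yC rmorphM.
by rewrite !mulrA -(mulrA eps _ eps) psi_eps mulrA epsK.
Qed.

Lemma tower_ringM x y : tower_ring x -> tower_ring y -> tower_ring (x * y).
Proof.
move=> /tower_ring_coef[A xA] /tower_ring_coef[C yC] i j.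
by exists ((A *m C) i j); exact: corner_mulmx.
Qed.

(** The relative inverse comes from the matrix identity A (pinvmx A) A = A, true for
    all matrices over a field. *)
Lemma tower_ring_regular x : tower_ring x ->
  exists2 y, tower_ring y & x * y * x = x.
Proof.
move=> /tower_ring_coef[A xA]; pose P := pinvmx A.
pose y := \sum_(l < N) \sum_(m < N) t ^+ l * (eps * psi (P l m)) * star t ^+ m.
have yP (i j : 'I_N) : corner y i j = eps * psi (P i j).
  rewrite corner_build // => l m; first by rewrite mulrA epsK.
  by rewrite -mulrA psi_eps mulrA epsK.
exists y; first by move=> i j; exists (P i j).
apply: corner_inj => i j; rewrite xA -[A in RHS](mulmxKpV (submx_refl A)).
by apply: corner_mulmx => // {}i {}j; apply: corner_mulmx.
Qed.

(** In the odometer algebra this applies to the functions that are constant on each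
    level of the tower: x is the scalar psi f on the j-th level. *)
Lemma tower_ring_diag x :
  (forall j : 'I_N, exists f, x * t ^+ j * eps = t ^+ j * eps * psi f) ->
  tower_ring x.
Proof.
move=> h i j; have [f xf] := h j; have := corner1 i j.
rewrite /corner mulr1 -!mulrA (mulrA x) xf !mulrA => ->.
by case: ifP => _; [exists f | exists 0; rewrite rmorph0 mul0r mulr0].
Qed.

Let psi_tX f k : psi f * t ^+ k = t ^+ k * psi f.
Proof. exact/commrX/psi_t. Qed.

Lemma tower_ring_psi f : tower_ring (psi f).
Proof.
by apply: tower_ring_diag => j; exists f; rewrite psi_tX -!mulrA psi_eps.
Qed.

(** t moves each level to the next one, and the last one back to the base, where the
    first return is t ^ N; that entry is a scalar because t ^ N lies in psi F. *)
Lemma tower_ring_t : (exists f, psi f = t ^+ N) -> tower_ring t.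
Proof.
move=> [f tN] i j; rewrite /corner -(mulrA _ t) -exprS.
have [lt|] := ltnP j.+1 N.
  have := corner1 i (Ordinal lt); rewrite /corner mulr1 => ->.
  by case: ifP => _; [exists 1; rewrite rmorph1 mulr1 | exists 0; rewrite rmorph0 mulr0].
move=> le; have -> : j.+1 = N by apply/eqP; rewrite eqn_leq le ltn_ord.
rewrite -(mulrA eps) corner_shift ?(ltnW (ltn_ord i)) //.
have [i0|i0] := posnP i; first by exists f; rewrite i0 subn0 -tN -mulrA psi_eps mulrA epsK.
exists 0; rewrite rmorph0 mulr0 tower_disjoint // subn_gt0 ltn_ord /=.
by rewrite ltn_subrL i0 (leq_ltn_trans _ (ltn_ord i)).
Qed.

Section StarClosed.
Hypothesis psi_star : forall f, exists g, star (psi f) = psi g.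

Lemma tower_ring_star x : tower_ring x -> tower_ring (star x).
Proof.
move=> Dx i j; have [f xf] := Dx j i; have [g fg] := psi_star f.
by exists g; rewrite corner_star xf starM tower_star // fg psi_eps.
Qed.

Hypothesis psi_pos : forall a : 'I_N -> F,
  \sum_i star (psi (a i)) * psi (a i) = 0 -> forall i, a i = 0.
Hypothesis nontrivial : (1 : B) <> 0.

(** The diagonal entries of star x * x are eps times sums of elements
    star (psi a) * psi a, where a runs over a column of the matrix of x. *)
Lemma tower_ring_proper x : tower_ring x -> star x * x = 0 -> x = 0.
Proof.
move=> /tower_ring_coef[A xA] xx; apply: corner_inj => i j.
rewrite xA [corner 0 _ _]/corner mulr0 !mul0r.
have [g gP] : exists g, \sum_l star (psi (A l j)) * psi (A l j) = psi g.
  have /boolp.choice[h hP] : forall l, exists g, star (psi (A l j)) = psi g.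
    by move=> l; exact: psi_star.
  by exists (\sum_l h l * A l j); rewrite rmorph_sum; apply: eq_bigr => l _; rewrite rmorphM hP.
(* g is the sum attached to the column j, so the (j, j) entry of star x * x = 0 is
   eps * psi g *)
have epsg : eps * psi g = 0.
  have := congr1 (fun z => corner z j j) xx.
  rewrite {2}/corner mulr0 !mul0r corner_mul => <-; rewrite -gP mulr_sumr.
  apply: eq_bigr => l _; rewrite corner_star xA starM tower_star //.
  have [h ->] := psi_star (A l j).
  by rewrite !mulrA -(mulrA _ eps eps) epsK psi_eps.
have [g0|g0] := eqVneq g 0.
  by rewrite (psi_pos (a := A ^~ j)) ?rmorph0 ?mulr0 // gP g0 rmorph0.
have eps0 : eps = 0.
  by rewrite -[eps]mulr1 -(rmorph1 psi) -(divff g0) rmorphM mulrA epsg mul0r.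
case: nontrivial; rewrite -(tower_cover tower) big1 // => l _.
by rewrite eps0 mulr0 mul0r.
Qed.

Lemma tower_ring_star_regular : star_regular_subring tower_ring.
Proof.
split; [exact: tower_ring1 | exact: tower_ringB | exact: tower_ringM |
  exact: tower_ring_star | exact: tower_ring_regular | exact: tower_ring_proper].
Qed.

End StarClosed.

(** A k x k matrix over the N x N matrices is a kN x kN matrix; the pairs in
    'I_k * 'I_N index its rows and columns. *)
Lemma tower_ring_rank (R : realType) (rk : matrix_fun B R) k (M : 'M[B]_k) :
  sylvester_rank rk -> (forall i j, tower_ring (M i j)) ->
  exists r : nat, rk _ _ M = r%:R * elt_rank rk eps.
Proof.
move=> rkS DM.
have /boolp.choice[A AP] : forall ij : 'I_k * 'I_k, exists A : 'M[F]_N,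
    forall a b : 'I_N, corner (M ij.1 ij.2) a b = eps * psi (A a b).
  by move=> ij; exact: tower_ring_coef.
pose T : finType := ('I_k * 'I_N)%type.
pose ev (p : 'I_#|T|) : T := enum_val p.
pose Row : 'M[B]_(k, #|T|) :=
  \matrix_(a, p) if a == (ev p).1 then t ^+ (ev p).2 * eps else 0.
pose Col : 'M[B]_(#|T|, k) :=
  \matrix_(p, a) if a == (ev p).1 then eps * star t ^+ (ev p).2 else 0.
pose AA : 'M[F]_#|T| := \matrix_(p, q) A ((ev p).1, (ev q).1) (ev p).2 (ev q).2.
exists (\rank AA); apply: (@rk_corner _ _ _ _ psi _ _ _ Row Col) => //.
- apply/matrixP => a b; rewrite !mxE.
  pose G (x : T) := (if a == x.1 then t ^+ x.2 * eps else 0) *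
                    (if b == x.1 then eps * star t ^+ x.2 else 0).
  transitivity (\sum_(x : T) G x).
    rewrite (reindex ev) /=; last exact/onW_bij/enum_val_bij.
    by apply: eq_bigr => p _; rewrite !mxE.
  rewrite -(pair_bigA _ (fun x y => G (x, y))) /= (bigD1 a) //= [X in _ + X]big1 ?addr0.
    rewrite /G /= eqxx eq_sym; case: eqP => _; last by rewrite big1 // => i _; rewrite mulr0.
    by rewrite -[RHS](tower_cover tower); apply: eq_bigr => i _; rewrite mulrA -(mulrA _ eps eps) epsK.
  by move=> c /negPf ca; rewrite big1 // => i _; rewrite /G /= eq_sym ca mul0r.
- apply/matrixP => p q; rewrite !mxE (bigD1 (ev p).1) //= [X in _ + X]big1 ?addr0.
    rewrite !mxE eqxx; have -> : (p == q) = (ev p == ev q) by rewrite (inj_eq enum_val_inj).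
    rewrite -pair_eqE /=; case: eqP => _ /=; last by rewrite mulr0.
    by have := corner1 (ev p).2 (ev q).2; rewrite /corner mulr1 !mulrA => ->; case: ifP.
  by move=> a /negPf ap; rewrite !mxE ap mul0r.
apply/matrixP => p q; rewrite mul_scalar_mx !mxE.
rewrite (bigD1 (ev q).1) //= [X in _ + X]big1 ?addr0.
  rewrite !mxE eqxx (bigD1 (ev p).1) //= [X in _ + X]big1 ?addr0.
    by rewrite !mxE eqxx -AP /corner !mulrA.
  by move=> a /negPf ap; rewrite !mxE ap mul0r.
by move=> a /negPf aq; rewrite !mxE aq mulr0.
Qed.

End Tower.

(** * Rational functions of a unitary element *)
Lemma positive_definite_fin (K : starFieldType) (I : finType) (a : I -> K) :
  positive_definite K -> \sum_i star (a i) * a i = 0 -> forall i, a i = 0.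
Proof.
move=> Kpos a0 i.
have [r cr] : exists r, #|I| = r.+1.
  by exists #|I|.-1; rewrite prednK //; apply/card_gt0P; exists i.
pose h (k : 'I_r.+1) : I := enum_val (cast_ord (esym cr) k).
pose h' x : 'I_r.+1 := cast_ord cr (enum_rank x).
have hK : cancel h h' by move=> k; rewrite /h /h' enum_valK cast_ordKV.
have h'K : cancel h' h by move=> x; rewrite /h /h' cast_ordK enum_rankK.
rewrite -[i]h'K; apply: (Kpos r (a \o h)).
by rewrite -[RHS]a0 [RHS](reindex h) //; exists h' => x _.
Qed.

Lemma map_fraction_inj (R : idomainType) (B : pzRingType) (psi : {rmorphism {fraction R} -> B}) x :
  (1 : B) <> 0 -> psi x = 0 -> x = 0.
Proof.
move=> B1 px; apply/eqP; apply/negPn/negP => x0; apply: B1.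
by rewrite -(rmorph1 psi) -(divff x0) rmorphM px mul0r.
Qed.

Section RationalFunctions.
Variables (B : starRingType) (K : starFieldType) (kappa : {rmorphism K -> B}) (s : B).
Variable (psi : {rmorphism {fraction {poly K}} -> B}).
Hypothesis psiC : forall c, psi (c%:P)%:F = kappa c.
Hypothesis psiX : psi 'X%:F = s.

(** Induction principle on the values psi p of the polynomials. *)
Lemma psi_range_poly (P : B -> Prop) :
  (forall c, P (kappa c)) -> P s -> (forall x y, P x -> P y -> P (x + y)) ->
  (forall x y, P x -> P y -> P (x * y)) -> forall p : {poly K}, P (psi p%:F).
Proof.
move=> Pk Ps PD PM; elim/poly_ind => [|p c IH]; first by rewrite -(polyC0 K) psiC.
by rewrite tofracD tofracM rmorphD rmorphM psiC psiX; apply: PD => //; apply: PM.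
Qed.

Lemma psi_fraction (x : {fraction {poly K}}) : exists n d : {poly K},
  d != 0 /\ exists b, [/\ psi d%:F * b = 1, b * psi d%:F = 1 & psi x = psi n%:F * b].
Proof.
have [n [d [d0 ->]]] := fraction_numden x; exists n, d; split=> //.
have d0' : d%:F != 0 by rewrite tofrac_eq0.
by exists (psi (d%:F^-1)); rewrite -!rmorphM divff // mulVf // rmorph1.
Qed.

Lemma psi_comm z : (forall c, kappa c * z = z * kappa c) -> s * z = z * s ->
  forall f, psi f * z = z * psi f.
Proof.
move=> kz sz f.
have polyz : forall p : {poly K}, psi p%:F * z = z * psi p%:F.
  apply: (psi_range_poly (P := fun x => x * z = z * x)) => // x y xz yz.
    by rewrite mulrDl mulrDr xz yz.
  by rewrite -mulrA yz mulrA xz mulrA.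
have [n [d [_ [b [db bd ->]]]]] := psi_fraction f.
have bz : z * b = b * z by apply: (comm_inverse db bd); rewrite polyz.
by rewrite -mulrA -bz mulrA polyz mulrA.
Qed.

Hypothesis kappa_star : forall c, star (kappa c) = kappa (star c).
Hypothesis sK : s * star s = 1.
Hypothesis Ks : star s * s = 1.
Hypothesis nontrivial : (1 : B) <> 0.

(** On K[s] because star s = s^-1 lies in psi (K(s)), then on fractions because the
    star of an inverse is the inverse of the star. *)
Lemma psi_star f : exists g, star (psi f) = psi g.
Proof.
have X0 : ('X : {poly K})%:F != 0 by rewrite tofrac_eq0 polyX_eq0.
have sV : star s = psi ('X%:F^-1).
  by rewrite -[LHS]mulr1 -(rmorph1 psi) -(divff X0) rmorphM psiX mulrA Ks mul1r.
have poly_star : forall p : {poly K}, exists g, star (psi p%:F) = psi g.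
  apply: (psi_range_poly (P := fun x => exists g, star x = psi g)).
  - by move=> c; exists ((star c)%:P%:F); rewrite psiC kappa_star.
  - by exists ('X%:F^-1).
  - by move=> x y [g xg] [h yh]; exists (g + h); rewrite starD xg yh rmorphD.
  - by move=> x y [g xg] [h yh]; exists (h * g); rewrite starM xg yh rmorphM.
have [n [d [d0 [b [db bd ->]]]]] := psi_fraction f.
have [[g ng] [h dh]] := (poly_star n, poly_star d).
have h0 : h != 0.
  apply/eqP => h0; have := congr1 star bd; rewrite starM dh h0 rmorph0 mul0r star1.
  by move/esym/nontrivial.
exists (h^-1 * g); rewrite starM ng rmorphM; congr (_ * _).
rewrite -[RHS]mulr1 -star1 -bd starM dh mulrA -rmorphM mulVf // rmorph1 mul1r //.
Qed.

Hypothesis kappa_s : forall c, kappa c * s = s * kappa c.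

Let psi_sum (p : {poly K}) n : (size p <= n)%N ->
  psi p%:F = \sum_(k < n) kappa p`_k * s ^+ k.
Proof.
move=> le; have pE : p = \poly_(i < n) p`_i.
  by apply/polyP => i; rewrite coef_poly; case: ltnP => // /(leq_trans le)/(nth_default 0).
rewrite [in LHS]pE poly_def [_%:F]rmorph_sum rmorph_sum; apply: eq_bigr => k _ /=.
rewrite -mul_polyC tofracM rmorphM psiC tofracXn rmorphXn psiX //.
Qed.

(** K(s), with the involution star s = s^-1, is positive definite.  After clearing
    denominators the a_i are polynomials p_i.  Then q_i = s^M star p_i is a
    polynomial with the conjugated coefficients of p_i in reverse order, and the
    coefficient of s^M in the sum of the q_i p_i is the sum of the star c * c over
    all coefficients c of all the p_i. *)
Lemma psi_positive (Kpos : positive_definite K) N (a : 'I_N -> {fraction {poly K}}) :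
  \sum_i star (psi (a i)) * psi (a i) = 0 -> forall i, a i = 0.
Proof.
move=> a0.
have /boolp.choice[num /boolp.choice[den nd]] := fun i => fraction_numden (a i).
pose D := \prod_i den i.
have D0 : D%:F != 0.
  by rewrite tofrac_eq0; apply/prodf_neq0 => i _; have [] := nd i.
pose p i := num i * \prod_(j | j != i) den j.
have pE i : (p i)%:F = a i * D%:F.
  have aN : a i * (den i)%:F = (num i)%:F.
    have [d0 aiE] := nd i; rewrite [X in X * _]aiE; apply: divfK.
    by rewrite tofrac_eq0.
  have -> : D = den i * \prod_(j | j != i) den j by rewrite /D (bigD1 i).
  by rewrite /p (tofracM (num i)) (tofracM (den i)) mulrA aN.
have p0 : \sum_i star (psi (p i)%:F) * psi (p i)%:F = 0.
  transitivity (star (psi D%:F) * (\sum_i star (psi (a i)) * psi (a i)) * psi D%:F).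
    rewrite mulr_sumr mulr_suml; apply: eq_bigr => i _.
    by rewrite pE rmorphM starM !mulrA.
  by rewrite a0 mulr0 mul0r.
(* M bounds all degrees, so that no coefficient is lost when reversing *)
pose M := \max_i size (p i).
have pM i : (size (p i) <= M.+1)%N by rewrite ltnW // ltnS leq_bigmax.
pose q i : {poly K} := \poly_(k < M.+1) star (p i)`_(M - k).
have qE i : psi (q i)%:F = s ^+ M * star (psi (p i)%:F).
  rewrite (@psi_sum _ M.+1) ?size_poly // (psi_sum (pM i)) star_sum mulr_sumr.
  rewrite (reindex_inj rev_ord_inj); apply: eq_bigr => k _ /=.
  rewrite coef_poly subSS ltnS leq_subr subKn; last by rewrite -ltnS.
  rewrite starM kappa_star starX mulrA.
  have -> : s ^+ M = s ^+ (M - k) * s ^+ k by rewrite -exprD subnK // -ltnS.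
  rewrite -(mulrA (s ^+ _)) expr_inverse // mulr1.
  exact/commrX/kappa_s.
have Q0 : \sum_i q i * p i = 0.
  have : psi (\sum_i q i * p i)%:F = 0.
    transitivity (s ^+ M * \sum_i star (psi (p i)%:F) * psi (p i)%:F);
      last by rewrite p0 mulr0.
    rewrite [_%:F]rmorph_sum rmorph_sum mulr_sumr.
    by apply: eq_bigr => i _ /=; rewrite tofracM rmorphM qE mulrA.
  by move/(map_fraction_inj nontrivial)/eqP; rewrite tofrac_eq0 => /eqP.
have pcoef0 : forall x : 'I_N * 'I_M.+1, (p x.1)`_(M - x.2) = 0.
  apply: positive_definite_fin => //.
  rewrite -(pair_bigA _ (fun i (k : 'I_M.+1) => star (p i)`_(M - k) * (p i)`_(M - k))) /=.
  transitivity ((\sum_i q i * p i)`_M); last by rewrite Q0 poly.coef0.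
  rewrite coef_sum; apply: eq_bigr => i _; rewrite coefM; apply: eq_bigr => k _.
  by rewrite coef_poly ltn_ord.
move=> i; apply/eqP; have : a i * D%:F == 0; last by rewrite mulf_eq0 (negPf D0) orbF.
rewrite -pE tofrac_eq0; apply/eqP/polyP => k; rewrite coefC if_same.
have [kM|Mk] := leqP k M; last by rewrite nth_default // (leq_trans (pM i)).
have := pcoef0 (i, Ordinal (leq_subr k M : (M - k < M.+1)%N)).
by rewrite /= subKn.
Qed.

End RationalFunctions.

Section PowerOfGenerator.
Variables (B : starRingType) (K : starFieldType) (kappa : {rmorphism K -> B}) (t : B).
Hypothesis kappa_t : forall c, kappa c * t = t * kappa c.
Hypothesis regular : forall ev : {rmorphism {poly K} -> B},
  (forall c, ev c%:P = kappa c) -> ev 'X = t -> forall q, q != 0 -> invertible (ev q).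

(** A polynomial in t ^ N is a polynomial in t, nonzero if the former is, so the
    invertibility of polynomials in t suffices for all powers. *)
Lemma psi_exists N : (0 < N)%N ->
  exists psi : {rmorphism {fraction {poly K}} -> B},
    (forall c, psi (c%:P)%:F = kappa c) /\ psi 'X%:F = t ^+ N.
Proof.
move=> N0.
have kappa_tN c : kappa c * t ^+ N = t ^+ N * kappa c by exact/commrX/kappa_t.
have [ev [evC evX]] := poly_lift kappa_t.
have [evN [evNC evNX]] := poly_lift kappa_tN.
have evNE q : evN q = ev (q \Po 'X^N).
  elim/poly_ind: q => [|q c IH]; first by rewrite comp_poly0 !rmorph0.
  by rewrite comp_poly_MXaddC !rmorphD !rmorphM IH evNC evC evNX rmorphXn evX.
have [psi psiE] : exists psi : {rmorphism {fraction {poly K}} -> B}, forall x, psi x%:F = evN x.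
  apply: fraction_lift => q q0; rewrite evNE; apply: regular => //.
  by rewrite comp_poly_eq0 // size_polyXn.
by exists psi; split=> [c|]; rewrite psiE.
Qed.

End PowerOfGenerator.

(** * Invertibility of polynomials in the generator *)
(** This element agrees with t below the top level of the tower and kills the top
    level, so its N-th power kills every level. *)
Lemma nilpotent_perturbation (B : starRingType) (t eps : B) N :
  (1 : B) <> 0 -> star t * t = 1 -> rokhlin_tower t eps N ->
  (t - t ^+ N * eps * star t ^+ N.-1) ^+ N = 0.
Proof.
move=> B1 Kt tower; set u := t - _.
have N0 : (0 < N)%N.
  case: N tower @u => // tower _; have := tower_cover tower.
  by rewrite big_ord0 => /esym/B1.
have ju j : (j < N)%N -> u * (t ^+ j * eps) = if j.+1 == N then 0 else t ^+ j.+1 * eps.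
  move=> jN; have N1 : (N.-1 < N)%N by rewrite prednK.
  have := corner1 Kt tower (Ordinal N1) (Ordinal jN).
  rewrite /corner mulr1 /= -!mulrA /u mulrBl -!mulrA => ->; rewrite -val_eqE /=.
  rewrite mulrA -exprS; have -> : (N.-1 == j) = (j.+1 == N) by rewrite -[N in RHS]prednK // eqSS eq_sym.
  by case: eqP => [->|_]; rewrite ?subrr // mulr0 subr0.
have kill k j : (j < N)%N -> (N <= j + k)%N -> u ^+ k * (t ^+ j * eps) = 0.
  elim: k j => [|k IH] j jN; first by rewrite addn0 leqNgt jN.
  move=> le; rewrite exprSr -mulrA ju //; case: eqP => [_|/eqP ne]; first by rewrite mulr0.
  by apply: IH; [rewrite ltn_neqAle ne | rewrite addSnnS].
rewrite -[LHS]mulr1 -(tower_cover tower) mulr_sumr big1 // => j _.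
by rewrite mulrA kill ?mul0r // leq_addl.
Qed.

Section PolynomialsInGenerator.
Variables (R : realType) (A B : starRingType).
Variables (rkA : matrix_fun A R) (rkB : matrix_fun B R) (iota : {rmorphism A -> B}).
Hypothesis compl : rank_completion rkA rkB iota.
Let rkS := completion_sylvester compl.
Local Notation rk1 := (elt_rank rkB).
Variables (K : fieldType) (kappa : {rmorphism K -> B}) (t : B).
Hypothesis kappa_t : forall c, kappa c * t = t * kappa c.
Hypothesis tK : t * star t = 1.
Hypothesis Kt : star t * t = 1.
Hypothesis towers : forall e : R, 0 < e -> exists eps N,
  [/\ rokhlin_tower t eps N, forall c, kappa c * eps = eps * kappa c & rk1 eps < e].

(** C is uniform in ev', so that the values of q converge along any sequence of
    approximations of ev 'X. *)
Lemma rank_poly_lipschitz (ev : {rmorphism {poly K} -> B}) (q : {poly K}) :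
  (forall c, ev c%:P = kappa c) ->
  exists C : nat, forall ev' : {rmorphism {poly K} -> B},
    (forall c, ev' c%:P = kappa c) ->
    rk1 (ev q - ev' q) <= C%:R * rk1 (ev 'X - ev' 'X).
Proof.
move=> evC; elim/poly_ind: q => [|q c [C IH]].
  by exists 0%N => ev' _; rewrite !rmorph0 subr0 elt_rank0 // mul0r.
exists C.+1 => ev' ev'C; rewrite !rmorphD !rmorphM evC ev'C.
have -> : ev q * ev 'X + kappa c - (ev' q * ev' 'X + kappa c) =
    (ev q - ev' q) * ev 'X + ev' q * (ev 'X - ev' 'X).
  by rewrite opprD addrACA subrr addr0 mulrBl mulrBr addrA subrK.
apply: le_trans (elt_rankD rkS _ _) _; rewrite -natr1 [leRHS]mulrDl mul1r lerD //.
  exact: le_trans (elt_rank_mull rkS _ _) (IH _ ev'C).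
exact: elt_rank_mulr.
Qed.

(** Powers of t split off, so q may be assumed to have a nonzero constant term.  For
    u nilpotent, q is then coprime to X^N, and a Bezout relation evaluated at u
    inverts q(u). *)
Lemma poly_invertible (ev : {rmorphism {poly K} -> B}) (q : {poly K}) :
  (forall c, ev c%:P = kappa c) -> ev 'X = t -> q != 0 -> invertible (ev q).
Proof.
move=> evC evX q0; have [m [p + ->]] := multiplicity_XsubC q 0.
rewrite q0 subr0 /= => p0; rewrite rmorphM rmorphXn evX.
apply: invertibleM; last by apply: invertibleX; exists (star t).
apply: (invertible_of_rank_limit compl) => e e0.
have [C hC] := rank_poly_lipschitz p evC.
have [|eps [N [tower keps lt]]] := towers (e := e / C.+1%:R); first by rewrite divr_gt0.
have := nilpotent_perturbation (one_neq0 rkS) Kt tower.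
set z := star t ^+ N.-1; set u := t - _ => uN.
have ku c : kappa c * u = u * kappa c.
  rewrite /u mulrBl mulrBr kappa_t; congr (_ - _).
  have kz : kappa c * z = z * kappa c.
    by apply: commrX; apply: comm_inverse tK Kt _.
  have ktN : kappa c * t ^+ N = t ^+ N * kappa c by exact/commrX/kappa_t.
  by rewrite !mulrA ktN -!mulrA -kz !mulrA -(mulrA _ _ eps) keps !mulrA.
have [ev' [ev'C ev'X]] := poly_lift ku.
exists (ev' p); split.
  have /Bezout_eq1_coprimepP[[v w] /= vw] : coprimep p ('X ^+ N).
    by rewrite coprimep_expr // coprimepX.
  have e1 : ev' v * ev' p = 1.
    have := congr1 ev' vw; rewrite rmorphD !rmorphM rmorphXn ev'X uN mulr0 addr0.
    by rewrite rmorph1.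
  by exists (ev' v); split=> //; rewrite -rmorphM mulrC rmorphM.
apply: le_lt_trans (hC _ ev'C) _; rewrite evX ev'X.
have -> : t - u = t ^+ N * eps * z by rewrite /u opprB addrC subrK.
apply: (@le_lt_trans _ _ (C%:R * rk1 eps)).
  apply: ler_wpM2l; rewrite ?ler0n //.
  apply: le_trans (elt_rank_mull rkS _ _) _; exact: elt_rank_mulr.
apply: (@le_lt_trans _ _ (C.+1%:R * rk1 eps)).
  by rewrite ler_wpM2r ?elt_rank_ge0 // ler_nat.
by rewrite mulrC -ltr_pdivlMr.
Qed.

End PolynomialsInGenerator.

(** * Dynamics of the odometer *)
Section OdometerIndex.
Variable n : odometer_base.
Notation X := (odometer_space n).
Notation T := (odometer_homeo n).
Implicit Types x y : X.

Definition modulus m : nat := (\prod_(i < m) n i)%N.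

(** The integer with mixed radix digits x 0, ..., x (m - 1); it turns the odometer
    into the addition of 1 modulo n 0 ... n (m - 1). *)
Definition digit_index x m : nat :=
  (\sum_(i < m) (x i : 'I_(n i)) * modulus i)%N.

Lemma modulusS m : modulus m.+1 = (modulus m * n m)%N.
Proof. exact: big_ord_recr. Qed.

Lemma modulus_gt m : (m < modulus m)%N.
Proof.
elim: m => [|m IH]; first by rewrite /modulus big_ord0.
rewrite modulusS; apply: (@leq_trans (modulus m * 2)); last by rewrite leq_mul2l base_ge2 orbT.
by rewrite muln2 -addnn -addn1 leq_add // (leq_ltn_trans _ IH).
Qed.

Lemma modulus_gt0 m : (0 < modulus m)%N.
Proof. exact: leq_ltn_trans (modulus_gt m). Qed.

Lemma indexS x m : digit_index x m.+1 = ((x m : 'I_(n m)) * modulus m + digit_index x m)%N.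
Proof. by rewrite addnC; exact: big_ord_recr. Qed.

Lemma index_lt x m : (digit_index x m < modulus m)%N.
Proof.
elim: m => [|m IH]; first by rewrite /digit_index /modulus !big_ord0.
rewrite indexS modulusS; apply: (@leq_trans ((x m : 'I_(n m)).+1 * modulus m)).
  by rewrite mulSn addnC ltn_add2r.
by rewrite mulnC leq_mul2l ltn_ord orbT.
Qed.

Lemma index_mod x m k : (m <= k)%N -> (digit_index x k %% modulus m)%N = digit_index x m.
Proof.
move=> mk; rewrite -(subnKC mk); elim: (k - m)%N => [|j IH].
  by rewrite addn0 modn_small // index_lt.
rewrite addnS indexS -modnDm IH; suff -> : (((x (m + j)%N : 'I_(n (m + j))) * modulus (m + j)) %% modulus m = 0)%N.
  by rewrite add0n modn_small // index_lt.
apply/eqP/dvdn_mull; elim: j {IH} => [|j IH]; first by rewrite addn0.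
by rewrite addnS modulusS dvdn_mulr.
Qed.

Lemma index_digits x y m : digit_index x m = digit_index y m <-> forall i, (i < m)%N -> x i = y i.
Proof.
split=> [|e]; last by apply: eq_bigr => i _; rewrite e.
elim: m => // m IH; move=> e i; rewrite ltnS leq_eqVlt => /orP[/eqP->|].
  have := congr1 (fun k => k %/ modulus m)%N e; rewrite !indexS !divnMDl ?modulus_gt0 //.
  by rewrite !divn_small ?index_lt // !addn0 => /val_inj.
apply: IH; have := congr1 (fun k => k %% modulus m)%N e.
by rewrite !indexS !modnMDl !modn_small ?index_lt.
Qed.

(** By induction on m, together with the fact that the first m digits are all maximal
    exactly when their index is. *)
Lemma index_odometer x m : digit_index (T x) m = ((digit_index x m).+1 %% modulus m)%N.
Proof.
suff [e1 e2] : (max_digits x m = ((digit_index x m).+1 == modulus m)) /\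
    digit_index (T x) m = if max_digits x m then 0%N else (digit_index x m).+1.
  rewrite e2 e1; case: eqP => [->|/eqP ne]; first by rewrite modnn.
  by rewrite modn_small // ltn_neqAle ne index_lt.
elim: m => [|m [IH1 IH2]]; first by rewrite /digit_index /modulus !big_ord0.
have maxS : max_digits x m.+1 = max_digits x m && ((x m : 'I_(n m)).+1 == n m).
  by rewrite /max_digits -addn1 iotaD all_cat /= andbT.
rewrite maxS !indexS IH2 modulusS [T x m]/= /odometer.
have lt := index_lt x m; have ltx := ltn_ord (x m : 'I_(n m)).
case: (boolP (max_digits x m)) IH1 => /= _ IH1.
  have e : ((digit_index x m).+1 = modulus m)%N by apply/eqP; rewrite -IH1.
  rewrite -addnS e addnC -mulSn mulnC eqn_pmul2l ?modulus_gt0 //; split=> //.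
  case: eqP => [->|/eqP ne]; first by rewrite modnn mul0n.
  by rewrite modn_small ?addn0 1?mulnC // ltn_neqAle ne.
split; last by rewrite addnS.
apply/esym/eqP => e.
have := congr1 (fun k => k %% modulus m)%N e.
by rewrite -addnS modnMDl modnMr modn_small // ltn_neqAle -IH1.
Qed.

Lemma index_odometer_iter x m k :
  digit_index (iter k T x) m = ((digit_index x m + k) %% modulus m)%N.
Proof.
elim: k => [|k IH]; first by rewrite addn0 modn_small ?index_lt.
by rewrite iterS index_odometer IH addnS -addn1 modnDml addn1.
Qed.

Lemma near_index x m : \forall y \near x, digit_index y m = digit_index x m.
Proof. by apply: filterS (near_digits x m) => y xy; apply/index_digits. Qed.

Definition zero_point : X := fun i => Ordinal (ltnW (base_ge2 n i)).

Lemma index_zero_point m : digit_index zero_point m = 0%N.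
Proof. by apply: big1 => i _; rewrite mul0n. Qed.

Lemma cvg_digits (u : nat -> X) x :
  (forall m i, (i < m)%N -> u m i = x i) -> u @ \oo --> x.
Proof.
move=> ux; apply/cvg_sup => i U [V [[W oW <-] /= Wx] VU].
exists i.+1 => // m /= im; apply: VU; rewrite /= ux //.
Qed.

Lemma compact_odometer_space : compact [set: X].
Proof.
have := @tychonoff _ (digit n) (fun i => [set: digit n i]).
have -> : [set f : forall i, digit n i | forall i, [set: digit n i] (f i)] = setT.
  by apply/seteqP; split.
by apply=> i; apply: finite_compact; exact: (@finite_finset 'I_(n i)).
Qed.

(** Compactness.  Otherwise there are, for every m, two points with the same first m
    digits at which f differs; a cluster point p of the first of them contradicts
    the constancy of f on a cylinder around p. *)
Lemma locally_constant_index (K : Type) (f : X -> K) : locally_constant f ->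
  exists m, forall x y, digit_index x m = digit_index y m -> f x = f y.
Proof.
move=> lf; apply: contrapT => nm.
have /boolp.choice[z zP] : forall m, exists z : X * X,
    digit_index z.1 m = digit_index z.2 m /\ f z.1 <> f z.2.
  move=> m; apply: contrapT => nz; apply: nm; exists m => x y xy.
  by apply: contrapT => fxy; apply: nz; exists (x, y).
have [p [_ clp]] : [set: X] `&` cluster ((fun m => (z m).1) @ \oo) !=set0.
  by apply: compact_odometer_space; exact: filterT.
(* cylinders around p form a basis of neighborhoods, here via sequences tending to p *)
have [M hM] : exists M, forall y, digit_index y M = digit_index p M -> f y = f p.
  apply: contrapT => nM.
  have /boolp.choice[u uP] : forall m, exists y : X, digit_index y m = digit_index p m /\ f y <> f p.
    move=> m; apply: contrapT => ny; apply: nM; exists m => y e.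
    by apply: contrapT => fy; apply: ny; exists y.
  have up : u @ \oo --> p.
    by apply: cvg_digits => m; apply/index_digits; have [] := uP m.
  have [N _ hN] := up _ (lf p).
  by have [_] := uP N; apply; apply: (hN N) => /=.
have [|q [[m Mm <-] qp]] := clp ((fun m => (z m).1) @` [set m | (M <= m)%N]) _ _ (near_index p M).
  by exists M => // m /= Mm; exists m.
have [e ne] := zP m; apply: ne; rewrite hM // [RHS]hM //.
by rewrite -(index_mod _ (k := m)) // -e index_mod.
Qed.

End OdometerIndex.

(** * The odometer algebra *)
Section CrossedProduct.
Variables (A : starRingType) (s : star_aut A).
Notation C := (crossed s).
Notation const := (crossed_const s).
Notation t := (crossed_gen s).

Let coefDE (a b : C) k : coef (a + b) k = coef a k + coef b k.
Proof. exact: Defs.coefD. Qed.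
Let coef0E k : coef (0 : C) k = 0. Proof. exact: Defs.coef0. Qed.
Let coefcM x (a : C) k : coef (const x * a) k = x * coef a k.
Proof. exact: coef_constM. Qed.
Let coeftM (a : C) k : coef (t * a) k = s (coef a (k - 1)).
Proof. exact: coef_genM. Qed.

Lemma crossed_constD x y : const (x + y) = const x + const y.
Proof.
apply: crossedP => k; rewrite coefDE !coef_const.
by case: ifP => _ //; rewrite addr0.
Qed.

Lemma crossed_constM x y : const (x * y) = const x * const y.
Proof.
apply: crossedP => k; rewrite coefcM !coef_const.
by case: ifP => _ //; rewrite mulr0.
Qed.

Lemma crossed_const1 : const 1 = 1. Proof. by []. Qed.

Lemma crossed_const0 : const 0 = 0.
Proof. by apply: (addrI (const 0)); rewrite -crossed_constD !addr0. Qed.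

Lemma crossed_const_sum I (r : seq I) (F : I -> A) :
  const (\sum_(i <- r) F i) = \sum_(i <- r) const (F i).
Proof. exact: (big_morph _ crossed_constD crossed_const0). Qed.

Lemma star_crossed_const x : star (const x) = const (star x).
Proof.
apply: crossedP => k; transitivity (aut_pow s k (star (coef (const x) (- k)))).
  exact: coef_star.
rewrite !coef_const oppr_eq0.
by case: eqP => [->|_] //; rewrite star0 aut_pow_zero.
Qed.

(** An element is the finite sum of its monomials a_k t^k, with k in Z, and the
    negative powers of t are powers of star t. *)
Lemma crossed_ind (P : C -> Prop) :
  (forall x, P (const x)) -> P t -> P (star t) ->
  (forall a b, P a -> P b -> P (a + b)) -> (forall a b, P a -> P b -> P (a * b)) ->
  forall a, P a.
Proof.
move=> Pc Pt Pst PD PM a.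
pose mono (k : int) : C := mkcrossed s [fset k]%fset (fun j => if j == k then 1 else 0).
have coef_mono k j : coef (mono k) j = if j == k then 1 else 0.
  by rewrite mkcrossedE // inE => /negPf->.
have monoS k : t * mono k = mono (k + 1).
  apply: crossedP => j; rewrite coeftM !coef_mono subr_eq.
  by case: eqP => _; [exact: aut1 | exact: (aut_pow_zero s 1)].
have monoP k : star t * mono k = mono (k - 1).
  have [_ tt] := crossed_gen_unitary s.
  by rewrite -{1}(subrK 1 k) -monoS mulrA tt mul1r.
have Pmono k : P (mono k).
  elim/int_ind: k => [|k IH|k IH].
  - have -> : mono 0 = const 1; last exact: Pc.
    by apply: crossedP => j; rewrite coef_mono.
  - by rewrite -addn1 PoszD -monoS; apply: PM.
  - by rewrite -addn1 PoszD opprD -monoP; apply: PM.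
have aE : a = \sum_(k <- csupp a) const (coef a k) * mono k.
  apply: crossedP => j.
  have coef_sum (r : seq int) : coef (\sum_(k <- r) const (coef a k) * mono k) j =
      \sum_(k <- r) if j == k then coef a k else 0.
    rewrite (big_morph (fun b : C => coef b j) (id1 := 0) (op1 := +%R)); first last.
    - by rewrite coef0E.
    - by move=> b c; rewrite coefDE.
    apply: eq_bigr => k _; rewrite coefcM coef_mono.
    by case: ifP => _; rewrite ?mulr1 ?mulr0.
  rewrite coef_sum; have [ja|ja] := boolP (j \in csupp a).
    rewrite (big_fsetD1 j) //= eqxx big_seq big1 ?addr0 // => k.
    by rewrite !inE eq_sym => /andP[/negPf -> _].
  rewrite coef_out // big_seq big1 // => k ka; case: eqP => // e.
  by rewrite -e (negPf ja) in ka.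
rewrite aE; apply: big_ind => //; first by rewrite -crossed_const0.
by move=> k _; apply: PM.
Qed.

End CrossedProduct.

Section OdometerAlgebra.
Variables (K : starFieldType) (n : odometer_base).
Notation X := (odometer_space n).
Notation T := (odometer_homeo n).
Notation O := (odometer_alg K n).
Notation t := (crossed_gen (homeo_aut K T) : O).
Implicit Types (x : X) (g : nat -> K).

Let const f : O := crossed_const (homeo_aut K T) f.

Lemma lc_index_subproof m g : locally_constant (fun x => g (digit_index x m)).
Proof. by move=> x; have := near_index x m; apply: filterS => y /= ->. Qed.

Definition lc_index m g : lcfun X K := mklc (lc_index_subproof m g).

Lemma lc_indexE m g x : lc_index m g x = g (digit_index x m).
Proof. by []. Qed.

(** The functions of the first m digits, as elements of the odometer algebra. *)
Definition index_const m g : O := const (lc_index m g).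

Lemma index_const_ext m g g' :
  (forall a, (a < modulus n m)%N -> g a = g' a) -> index_const m g = index_const m g'.
Proof.
move=> e; congr (crossed_const _ _); apply: lcfunP => x.
by rewrite !lc_indexE e // index_lt.
Qed.

Lemma index_constM m g g' :
  index_const m g * index_const m g' = index_const m (fun a => g a * g' a).
Proof. by rewrite -crossed_constM; congr (crossed_const _ _); exact: lcfunP. Qed.

Lemma index_constD m g g' :
  index_const m g + index_const m g' = index_const m (fun a => g a + g' a).
Proof. by rewrite -crossed_constD; congr (crossed_const _ _); exact: lcfunP. Qed.

Lemma index_const_sum m I (r : seq I) (G : I -> nat -> K) :
  \sum_(i <- r) index_const m (G i) = index_const m (fun a => \sum_(i <- r) G i a).
Proof.
elim: r => [|i r IH].
  rewrite big_nil -(crossed_const0 (homeo_aut K T)); congr (crossed_const _ _).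
  by apply: lcfunP => x; rewrite lc_indexE big_nil.
rewrite big_cons IH index_constD; apply: index_const_ext => a _.
by rewrite big_cons.
Qed.

Lemma index_const1 m : index_const m (fun=> 1) = 1.
Proof. by rewrite -crossed_const1; congr (crossed_const _ _); exact: lcfunP. Qed.

Lemma index_const0 m : index_const m (fun=> 0) = 0.
Proof. by rewrite -crossed_const0; congr (crossed_const _ _); exact: lcfunP. Qed.

Lemma index_const_star m g :
  star (index_const m g) = index_const m (fun a => star (g a)).
Proof. by rewrite star_crossed_const; congr (crossed_const _ _); exact: lcfunP. Qed.

Lemma index_const_widen m k g : (m <= k)%N ->
  index_const m g = index_const k (fun a => g (a %% modulus n m)%N).
Proof.
move=> mk; congr (crossed_const _ _); apply: lcfunP => x.
by rewrite !lc_indexE index_mod.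
Qed.

Lemma const_index f : exists m, forall k, (m <= k)%N -> exists g, const f = index_const k g.
Proof.
have [m hm] := locally_constant_index (@lcfun_lc _ _ f); exists m => k mk.
have /boolp.choice[g gP] : forall a, exists c, forall x, digit_index x k = a -> f x = c.
  move=> a; have [[x xa]|nx] := pselect (exists x : X, digit_index x k = a).
    exists (f x) => y ya; apply: hm.
    by rewrite -(index_mod _ mk) ya -xa index_mod.
  by exists 0 => x xa; case: nx; exists x.
exists g; congr (crossed_const _ _); apply: lcfunP => x.
by rewrite lc_indexE; exact: gP.
Qed.

(** Conjugation by t ^ k translates the digit index by k. *)
Lemma index_const_genX m g k :
  index_const m g * t ^+ k =
  t ^+ k * index_const m (fun a => g ((a + k) %% modulus n m)%N).
Proof.
elim: k g => [|k IH] g.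
  rewrite expr0 mulr1 mul1r; apply: index_const_ext => a am.
  by rewrite addn0 modn_small.
have step : index_const m g * t = t * index_const m (fun a => g (a.+1 %% modulus n m)%N).
  rewrite [RHS]crossed_genE; congr (_ * _); congr (crossed_const _ _).
  apply: lcfunP => x; rewrite /= -index_odometer.
  by have /= -> := homeo_invK T x.
rewrite exprS mulrA step -!mulrA IH; congr (_ * (_ * _)).
by apply: index_const_ext => a am; rewrite addnS -addn1 modnDml addn1.
Qed.

(** The characteristic function of the base of the tower of height modulus n m. *)
Definition base_proj m : O := index_const m (fun a => (a == 0%N)%:R).

Lemma index_clopen m (P : nat -> Prop) : clopen [set x : X | P (digit_index x m)].
Proof.
have op Q : open [set x : X | Q (digit_index x m)].
  by rewrite openE => x Qx; have := near_index x m; apply: filterS => y /= ->.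
split; first exact: op.
by rewrite -[X in closed X]setCK; apply: open_closedC; exact: (op (fun a => ~ P a)).
Qed.

Lemma chi_index m (P : pred nat) (cU : clopen [set x : X | P (digit_index x m)]) :
  chi K cU = index_const m (fun a => (P a)%:R).
Proof.
congr (crossed_const _ _); apply: lcfunP => x; rewrite lc_indexE /= indicE.
congr ((_ : bool)%:R); exact: asboolb.
Qed.

(** The embedding of K, by functions that depend on no digit. *)
Definition field_const c : O := index_const 0 (fun=> c).

Lemma field_constE m c : field_const c = index_const m (fun=> c).
Proof. exact: index_const_widen. Qed.

Lemma field_const_comm_index m g c : field_const c * index_const m g = index_const m g * field_const c.
Proof. by rewrite (field_constE m) !index_constM; apply: index_const_ext => a _; rewrite mulrC. Qed.

Lemma field_const_comm_gen c : field_const c * t = t * field_const c.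
Proof. exact: (@index_const_genX 0 (fun=> c) 1). Qed.

Lemma field_const_rmorphism : exists kappa : {rmorphism K -> O}, kappa =1 field_const.
Proof.
have sD : {morph field_const : c d / c + d} by move=> c d; rewrite [RHS]index_constD.
apply: pack_rmorphism => [c d||c d]; last by rewrite [RHS]index_constM.
  have sN : field_const (- d) = - field_const d.
    by apply: (addrI (field_const d)); rewrite -sD !subrr [LHS]index_const0.
  by rewrite sD sN.
exact: index_const1.
Qed.

Lemma star_field_const c : star (field_const c) = field_const (star c).
Proof. exact: index_const_star. Qed.

Lemma index_const_base m g j :
  index_const m g * t ^+ j * base_proj m =
  t ^+ j * base_proj m * field_const (g (j %% modulus n m)%N).
Proof.
rewrite index_const_genX -!mulrA; congr (_ * _); rewrite -field_const_comm_index.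
rewrite (field_constE m) !index_constM; apply: index_const_ext => a am.
by case: eqP => [->|_]; rewrite ?mulr0 // add0n.
Qed.

Lemma base_proj_genX m : base_proj m * t ^+ modulus n m = t ^+ modulus n m * base_proj m.
Proof.
rewrite index_const_genX; congr (_ * _); apply: index_const_ext => a am.
by rewrite modnDr modn_small.
Qed.

Lemma base_tower m : rokhlin_tower t (base_proj m) (modulus n m).
Proof.
have [tt _] := crossed_gen_unitary (homeo_aut K T).
split.
- rewrite index_constM; apply: index_const_ext => a _.
  by case: eqP => _; rewrite ?mulr1 ?mulr0.
- rewrite index_const_star; apply: index_const_ext => a _.
  by case: eqP => _; rewrite ?star1 ?star0.
- move=> k /andP[k0 km]; rewrite index_const_genX -mulrA index_constM.
  rewrite (_ : index_const m _ = 0) ?mulr0 // -(index_const0 m).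
  apply: index_const_ext => a _; case: (eqVneq a 0%N) => [->|_]; last by rewrite mulr0.
  by rewrite add0n modn_small // (gtn_eqF k0) mul0r.
transitivity (\sum_(i < modulus n m) index_const m (fun a => (a == i)%:R)).
  apply: eq_bigr => i _.
  have -> : t ^+ i * base_proj m = index_const m (fun a => (a == i)%:R) * t ^+ i.
    rewrite index_const_genX; congr (_ * _); apply: index_const_ext => a am.
    congr ((_ : bool)%:R); apply/idP/idP => [/eqP->|].
      by rewrite add0n modn_small.
    move=> /eqP e; have := eqn_modDr i a 0 (modulus n m).
    by rewrite e add0n modn_small // eqxx modn_small // mod0n => /esym.
  by rewrite -mulrA expr_inverse // mulr1.
rewrite index_const_sum -(index_const1 m); apply: index_const_ext => a am.
rewrite (bigD1 (Ordinal am)) //= eqxx big1 ?addr0 // => i ia.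
by case: eqP => // e; move: ia; rewrite -val_eqE /= -e eqxx.
Qed.

End OdometerAlgebra.

(** * The union of the tower rings *)
Section StarRegularSubrings.
Variable B : starRingType.

Section Closure.
Variables (D : set B) (srD : star_regular_subring D).

Lemma srs0 : D 0.
Proof. by rewrite -(subrr 1); apply: (srs_sub srD); exact: (srs_one srD). Qed.

Lemma srs_add x y : D x -> D y -> D (x + y).
Proof.
move=> Dx Dy; rewrite -[y]opprK -[- y]sub0r; do 2!apply: (srs_sub srD) => //.
exact: srs0.
Qed.

Lemma srs_sum I (r : seq I) (f : I -> B) : (forall i, D (f i)) -> D (\sum_(i <- r) f i).
Proof. by move=> Df; apply: big_ind => //; [exact: srs0 | exact: srs_add]. Qed.

Lemma srs_exp x k : D x -> D (x ^+ k).
Proof.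
move=> Dx; elim: k => [|k IH]; first exact: (srs_one srD).
by rewrite exprS; apply: (srs_mul srD).
Qed.

(** A relative inverse of an invertible element is its inverse. *)
Lemma srs_inverse x y : D x -> x * y = 1 -> y * x = 1 -> D y.
Proof.
move=> /(srs_regular srD)[z Dz xzx] xy yx.
suff -> : y = z by [].
by rewrite -[y]mulr1 -xy -{1}xzx -!mulrA xy mulr1 mulrA yx mul1r.
Qed.

End Closure.

Lemma subset_chain (D : nat -> set B) m k :
  (forall m, D m `<=` D m.+1) -> (m <= k)%N -> D m `<=` D k.
Proof.
move=> DS mk; rewrite -(subnKC mk); elim: (k - m)%N => [|j IH]; first by rewrite addn0.
by rewrite addnS; apply: subset_trans IH _.
Qed.

Lemma star_regular_subring_bigcup (D : nat -> set B) :
  (forall m, star_regular_subring (D m)) -> (forall m, D m `<=` D m.+1) ->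
  star_regular_subring (\bigcup_m D m).
Proof.
move=> srD DS.
have both x y : (\bigcup_m D m) x -> (\bigcup_m D m) y -> exists m, D m x /\ D m y.
  move=> [m _ Dx] [k _ Dy]; exists (maxn m k).
  by split; [apply: subset_chain Dx; rewrite ?leq_maxl
            | apply: subset_chain Dy; rewrite ?leq_maxr].
split.
- by exists 0%N => //; exact: (srs_one (srD _)).
- by move=> x y Dx Dy; have [m [Dmx Dmy]] := both _ _ Dx Dy; exists m => //; apply: (srs_sub (srD _)).
- by move=> x y Dx Dy; have [m [Dmx Dmy]] := both _ _ Dx Dy; exists m => //; apply: (srs_mul (srD _)).
- by move=> x [m _ Dx]; exists m => //; apply: (srs_star (srD _)).
- by move=> x [m _ /(srs_regular (srD _))[y Dy xyx]]; exists y => //; exists m.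
- by move=> x [m _]; exact: (srs_proper (srD _)).
Qed.

End StarRegularSubrings.

Lemma rokhlin_tower_map (A B : starRingType) (iota : {rmorphism A -> B}) t eps N :
  (forall a, iota (star a) = star (iota a)) ->
  rokhlin_tower t eps N -> rokhlin_tower (iota t) (iota eps) N.
Proof.
move=> istar [pp ps pd pc]; split.
- by rewrite -rmorphM pp.
- by rewrite -istar ps.
- by move=> k kN; rewrite -rmorphXn -!rmorphM pd // rmorph0.
rewrite -[RHS](rmorph1 iota) -pc rmorph_sum; apply: eq_bigr => i _.
by rewrite !rmorphM !rmorphXn istar.
Qed.

Lemma base_proj_rank (R : realType) (K : starFieldType) (n : odometer_base)
    (mu : probability (odometer_borel n) R) (rk : matrix_fun (odometer_alg K n) R) m :
  uniform_product mu ->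
  (forall (U : set (odometer_space n)) (cU : clopen U), (elt_rank rk (chi K cU))%:E = mu U) ->
  elt_rank rk (@base_proj K n m) = (modulus n m)%:R^-1 /\
  elt_rank rk (index_const n m (fun a => (a != 0%N)%:R : K)) = 1 - (modulus n m)%:R^-1.
Proof.
move=> mu_prod rk_chi.
pose P (a : nat) := a == 0%N.
have muE : mu [set x | P (digit_index x m)] = ((modulus n m)%:R^-1)%:E.
  pose Z i : {set 'I_(n i)} := [set (zero_point n i : 'I_(n i))]%SET.
  transitivity (mu [set x : odometer_space n | forall i, (i < m)%N -> (x i : 'I_(n i)) \in Z i]).
    congr (mu _); apply/seteqP; split=> x /=.
      rewrite /P => /eqP e i im; rewrite inE; apply/eqP.
      by apply: (iffLR (index_digits x (zero_point n) m)) => //; rewrite e index_zero_point.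
    move=> h; rewrite /P -(index_zero_point n m); apply/eqP/index_digits => i im.
    by have := h i im; rewrite inE => /eqP.
  rewrite mu_prod; congr (_%:E); rewrite /modulus natr_prod -prodfV.
  by apply: eq_bigr => i _; rewrite cards1 mul1r.
split; apply/EFin_inj.
  by have := rk_chi _ (index_clopen n m P); rewrite (chi_index K) muE.
pose Q (a : nat) := a != 0%N.
have := rk_chi _ (index_clopen n m Q); rewrite (chi_index K) => ->.
transitivity (mu (~` [set x | P (digit_index x m)])).
  by congr (mu _); apply/seteqP; split=> x /=; rewrite /Q /P => /negP.
rewrite probability_setC ?muE ?EFinB //.
by apply: sub_sigma_algebra; case: (index_clopen n m P).
Qed.

Section Closure.
Variables (R : realType) (K : starFieldType) (n : odometer_base).
Hypothesis Kpos : positive_definite K.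
Variable mu : probability (odometer_borel n) R.
Hypothesis mu_prod : uniform_product mu.
Variable rk : matrix_fun (odometer_alg K n) R.
Hypothesis rk_chi : forall (U : set (odometer_space n)) (cU : clopen U),
  (elt_rank rk (chi K cU))%:E = mu U.
Variables (B : starRingType) (rkB : matrix_fun B R).
Variable iota : {rmorphism odometer_alg K n -> B}.
Hypothesis compl : rank_completion rk rkB iota.
Let rkS := completion_sylvester compl.

Lemma elt_rank_iota a : elt_rank rkB (iota a) = elt_rank rk a.
Proof. by rewrite /elt_rank -(completion_extends compl) map_scalar_mx. Qed.

(** D is the union of the rings of matrices over K(t^N_m).  They increase since the
    base of a tower is a union of levels of the next one, so the matrix units and
    K(t^N_m) all lie in the next ring: inverses stay in it by [srs_inverse]. *)
Lemma rational_values_on_tower_union : exists D : set B,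
  [/\ star_regular_subring D, range iota `<=` D &
      forall k (M : 'M[B]_k), (forall i j, D (M i j)) ->
      exists m r : nat, rkB M = r%:R / (modulus n m.+1)%:R].
Proof.
pose t : B := iota (crossed_gen _).
pose N m := modulus n m.+1.
pose eps m := iota (@base_proj K n m.+1).
have istar := completion_star compl.
have nontrivial := one_neq0 rkS.
have tK : t * star t = 1.
  by rewrite -istar -rmorphM (crossed_gen_unitary _).1 rmorph1.
have Kt : star t * t = 1.
  by rewrite -istar -rmorphM (crossed_gen_unitary _).2 rmorph1.
have tower m : rokhlin_tower t (eps m) (N m).
  by apply: rokhlin_tower_map => //; exact: base_tower.
have rk_eps m : elt_rank rkB (eps m) = (N m)%:R^-1.
  by rewrite elt_rank_iota; have [] := base_proj_rank m.+1 mu_prod rk_chi.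
have [kappa0 k0E] := field_const_rmorphism K n.
have [kappa kE] : exists kappa : {rmorphism K -> B}, forall c, kappa c = iota (field_const n c).
  have [|||g gE] := @pack_rmorphism K B (fun c => iota (kappa0 c)).
  - by move=> x y; rewrite !rmorphB.
  - by rewrite !rmorph1.
  - by move=> x y; rewrite !rmorphM.
  by exists g => c; rewrite gE k0E.
have kstar c : star (kappa c) = kappa (star c) by rewrite !kE -istar star_field_const.
have kt c : kappa c * t = t * kappa c by rewrite kE -!rmorphM field_const_comm_gen.
have keps m c : kappa c * eps m = eps m * kappa c.
  by rewrite kE -!rmorphM field_const_comm_index.
have towers (e : R) : 0 < e -> exists eps N,
    [/\ rokhlin_tower t eps N, forall c, kappa c * eps = eps * kappa c & elt_rank rkB eps < e].
  move=> e0; have [m _ hm] := near_infty_natSinv_lt (PosNum e0).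
  exists (eps m), (N m); split=> //; rewrite rk_eps.
  apply: le_lt_trans (hm m _) => //=.
  by rewrite lef_pV2 ?posrE ?ltr0n ?modulus_gt0 // ler_nat ltnW // modulus_gt.
have N0 m : (0 < N m)%N by exact: modulus_gt0.
have /boolp.choice[psi psiP] : forall m, exists psi : {rmorphism {fraction {poly K}} -> B},
    (forall c, psi (c%:P)%:F = kappa c) /\ psi 'X%:F = t ^+ N m.
  move=> m; apply: psi_exists => // ev evC evX q q0.
  exact: (poly_invertible compl kt tK Kt towers).
have psi_t m f : psi m f * t = t * psi m f.
  have [pC pX] := psiP m; apply: (psi_comm pC pX) => //.
  by rewrite -exprSr exprS.
have psi_eps m f : psi m f * eps m = eps m * psi m f.
  have [pC pX] := psiP m; apply: (psi_comm pC pX) => //.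
  by rewrite -rmorphXn -!rmorphM -base_proj_genX.
pose D m := tower_ring t (eps m) (N m) (psi m).
have srD m : star_regular_subring (D m).
  have [pC pX] := psiP m.
  have sK : t ^+ N m * star (t ^+ N m) = 1 by rewrite starX expr_inverse.
  have Ks : star (t ^+ N m) * t ^+ N m = 1 by rewrite starX expr_inverse.
  apply: tower_ring_star_regular => //.
    exact: (psi_star pC pX kstar Ks nontrivial).
  by move=> a; apply: (psi_positive pC pX kstar sK nontrivial) => // c; exact/commrX/kt.
have Dk m c : D m (kappa c).
  have [pC _] := psiP m; rewrite -pC; exact: tower_ring_psi.
have Dt m : D m t.
  by apply: tower_ring_t => //; have [_ pX] := psiP m; exists ('X%:F).
have Dconst m g : D m (iota (index_const n m.+1 g)).
  apply: tower_ring_diag => // j; have [pC _] := psiP m.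
  exists ((g (j %% N m)%N)%:P%:F); rewrite pC kE -rmorphXn -!rmorphM.
  by rewrite index_const_base.
have DS m : D m `<=` D m.+1.
  move=> x Dx; have srS := srD m.+1.
  have Deps : D m.+1 (eps m).
    by rewrite /eps /base_proj (index_const_widen n _ (leqnSn _)); exact: Dconst.
  have Dpsi f : D m.+1 (psi m f).
    have [pC pX] := psiP m.
    have Dp : forall p : {poly K}, D m.+1 (psi m p%:F).
      apply: (psi_range_poly pC pX) => [c||y z|y z]; first exact: Dk.
      - exact: (srs_exp srS).
      - exact: (srs_add srS).
      - exact: (srs_mul srS).
    have [p [d [_ [b [db bd ->]]]]] := psi_fraction (psi m) f.
    by apply: (srs_mul srS) => //; apply: (srs_inverse srS (Dp d)).
  rewrite (corner_decomp (tower m) x).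
  apply: (srs_sum srS) => i; apply: (srs_sum srS) => j.
  apply: (srs_mul srS); last by apply: (srs_exp srS); exact: (srs_star srS).
  apply: (srs_mul srS); first exact: (srs_exp srS).
  by have [f ->] := Dx i j; apply: (srs_mul srS).
have srU := star_regular_subring_bigcup srD DS.
exists (\bigcup_m D m); split=> //.
  move=> _ [a _ <-]; elim/crossed_ind: a => [f|||a b|a b].
  - have [m hm] := const_index f; have [g ->] := hm m.+1 (leqnSn m).
    by exists m.
  - by exists 0%N.
  - by rewrite istar; apply: (srs_star srU); exists 0%N.
  - by rewrite rmorphD; exact: (srs_add srU).
  - by rewrite rmorphM; exact: (srs_mul srU).
move=> k M DM.
have [m Dm] : exists m, forall i j, D m (M i j).
  have /boolp.choice[h hP] : forall ij : 'I_k * 'I_k, exists m, D m (M ij.1 ij.2).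
    by move=> ij; have [m _ Dm] := DM ij.1 ij.2; exists m.
  exists (\max_ij h ij) => i j; apply: (subset_chain DS) (hP (i, j)).
  exact: leq_bigmax.
have [r rE] := tower_ring_rank Kt (tower m) (psi_eps m) rkS Dm.
by exists m, r; rewrite rE rk_eps.
Qed.

End Closure.

(** * The values of the rank *)
(** The denominators of [Zn] have at least one factor, whence the index m + 1. *)
Lemma Zn_nnegP (R : realType) (n : odometer_base) (r : R) :
  ((@ratr R) @` Zn_nneg n) r <-> exists m a : nat, r = a%:R / (modulus n m.+1)%:R.
Proof.
split=> [[q [[a [m qE]] q0] <-]|[m [a ->]]].
  exists m, `|a|%N; rewrite qE fmorph_div rmorph_int rmorph_nat; congr (_ / _).
  have a0 : 0 <= a.
    rewrite -(ler_int rat); move: q0; rewrite qE pmulr_lge0 //.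
    by rewrite invr_gt0 ltr0n; exact: modulus_gt0.
  by rewrite natr_absz ger0_norm.
exists (a%:R / (modulus n m.+1)%:R); last by rewrite fmorph_div !rmorph_nat.
split; last by rewrite divr_ge0 ?ler0n.
by exists (Posz a), m.
Qed.

Lemma generated_Zn_nneg (R : realType) (n : odometer_base) :
  generated_subgroup ((@ratr R) @` Zn_nneg n) = (@ratr R) @` Zn n.
Proof.
apply/seteqP; split=> [r|_ [q [a [m qE]] <-] H [[H0 HB] sH]].
  apply; split.
    split; first by exists 0; rewrite ?rmorph0 //; exists 0, 0%N; rewrite mul0r.
    move=> _ _ [q [a [m qE]] <-] [p [b [k pE]] <-].
    exists (q - p); last by rewrite rmorphB.
    pose P j := modulus n j; have P0 j : (P j)%:R != 0 :> rat.
      by rewrite pnatr_eq0 -lt0n modulus_gt0.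
    have widen (i j : nat) : (i <= j)%N -> exists c : nat, (P j = P i * c)%N.
      move=> ij; rewrite -(subnKC ij); elim: (j - i)%N => [|l [c IH]].
        by exists 1%N; rewrite addn0 muln1.
      by exists (c * n (i + l))%N; rewrite addnS /P modulusS -/(P _) IH mulnA.
    have [c cE] := widen m.+1 (maxn m k).+1 (leq_maxl m k : (m.+1 <= (maxn m k).+1)%N).
    have [d dE] := widen k.+1 (maxn m k).+1 (leq_maxr m k : (k.+1 <= (maxn m k).+1)%N).
    have expand (z : int) (i j l : nat) : (P j = P i * l)%N ->
        z%:~R / (P i)%:R = (z * l%:Z)%:~R / (P j)%:R :> rat.
      move=> ji; have := P0 j; rewrite ji natrM mulf_eq0 negb_or => /andP[_ l0].
      by rewrite intrM -mulf_div -pmulrn divff // mulr1.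
    exists (a * c%:Z - b * d%:Z), (maxn m k).
    by rewrite intrB mulrBl qE pE; congr (_ - _); exact: expand.
  by move=> _ [q [Zq _] <-]; exists q.
have nneg (b : nat) : H (ratr (b%:R / (modulus n m.+1)%:R)).
  apply: sH; exists (b%:R / (modulus n m.+1)%:R) => //; split.
    by exists (Posz b), m.
  by rewrite divr_ge0 ?ler0n.
have Hnat := nneg `|a|%N.
rewrite qE; case: a Hnat {qE} => b Hb; first exact: Hb.
rewrite NegzE rmorphN mulNr rmorphN -sub0r; apply: HB => //.
Qed.

Theorem theorem5p6 (R : realType) (K : starFieldType) (n : odometer_base)
    (Kpos : positive_definite K)
    (mu : probability (odometer_borel n) R) (mu_prod : uniform_product mu)
    (rk : matrix_fun (odometer_alg K n) R) (rkS : sylvester_rank rk)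
    (rk_chi : forall (U : set (odometer_space n)) (cU : clopen U),
       (elt_rank rk (chi K cU))%:E = mu U)
    (Rrk : starRingType) (rkc : matrix_fun Rrk R)
    (iota : {rmorphism odometer_alg K n -> Rrk})
    (Rrk_completion : rank_completion rk rkc iota) :
  [/\ rank_values rk setT = betti_values rk,
      betti_values rk = rank_values rkc (star_regular_closure (range iota)),
      rank_values rkc (star_regular_closure (range iota)) =
        (@ratr R) @` Zn_nneg n
    & generated_subgroup (betti_values rk) = (@ratr R) @` Zn n].
Proof.
pose V : set R := (@ratr R) @` Zn_nneg n.
have [D [srD iotaD valD]] :=
  rational_values_on_tower_union Kpos mu_prod rk_chi Rrk_completion.
have rk_iota k (M : 'M[odometer_alg K n]_k) : rk _ _ M = rkc _ _ (map_mx iota M).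
  by rewrite (completion_extends Rrk_completion).
have valO k (M : 'M[odometer_alg K n]_k) : exists m a : nat, rk _ _ M = a%:R / (modulus n m.+1)%:R.
  rewrite rk_iota; apply: valD => i j; rewrite mxE; apply: iotaD; exact: imageT.
have N0 m : (modulus n m.+1)%:R != 0 :> R by rewrite pnatr_eq0 -lt0n modulus_gt0.
have valO_V : rank_values rk setT = V.
  apply/seteqP; split=> [_ [k [M [_ _ ->]]]|r /Zn_nnegP[m [a ->]]].
    exact/Zn_nnegP.
  have [re _] := base_proj_rank m.+1 mu_prod rk_chi.
  case: a => [|a]; last first.
    by exists a.+1, (base_proj K n m.+1)%:M; split=> //; rewrite rk_scalar // re.
  by exists 1%N, 0; split=> //; rewrite (rk_mx0 rkS) mul0r.
(* k - a / N has numerator k N - a, nonnegative since a rank is at most the size;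
   conversely the complement of the base has rank 1 - 1 / N *)
have betti_V : betti_values rk = V.
  apply/seteqP; split=> [_ [k [M [_ ->]]]|r /Zn_nnegP[m [a ->]]].
    have [m [a rE]] := valO _ M; apply/Zn_nnegP.
    have le := rk_le_size rkS M.
    exists m, (k * modulus n m.+1 - a)%N; rewrite rE natrB.
      by rewrite natrM mulrBl mulfK.
    rewrite -(ler_nat R) natrM -ler_pdivrMr ?ltr0n ?modulus_gt0 //.
    by rewrite -rE.
  have [_ re] := base_proj_rank m.+1 mu_prod rk_chi.
  case: a => [|a].
    by exists 1%N, 1%:M; split=> //; rewrite (rk_one rkS) subrr mul0r.
  exists a.+1, (index_const n m.+1 (fun b => (b != 0%N)%:R))%:M; split=> //.
  by rewrite rk_scalar // re mulrBr mulr1 opprB addrC subrK.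
have closure_V : rank_values rkc (star_regular_closure (range iota)) = V.
  apply/seteqP; split=> [_ [k [M [_ clM ->]]]|r].
    apply/Zn_nnegP/valD => i j; apply: clM; split=> //.
  rewrite -valO_V => -[k [M [k1 _ ->]]].
  exists k, (map_mx iota M); split=> // i j; rewrite mxE => E [_]; apply.
  exact: imageT.
split; rewrite ?valO_V ?betti_V ?closure_V //.
exact: generated_Zn_nneg.
Qed.
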